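(* Consider the two-dimensional regular lattice with the exponential-family testing problem (see context) and the uniform prior $\pi$ on $\mathcal{P}_m$, with Bayes risk $B_m(\pi)=\inf_{T_m}[\mathbf{P}_0(T_m=1)+\mathbf{E}_\pi\mathbf{P}_{1,p}(T_m=0)]$. If $\theta_m m^{1/4}\to\infty$, then $B_m(\pi)\to0$ (the Bayes test is asymptotically powerful). If $\theta_m m^{1/4}\to0$, then $B_m(\pi)\to1$, so every sequence of tests is asymptotically powerless.
   Context: Regular lattice: $V_m=\{(i,j)\in\mathbb{Z}^2: 0\le i\le m-1,\ -i\le j\le i,\ j\equiv i \pmod 2\}$ with oriented edges $(i,j)\to(i+1,j\pm1)$; $\mathcal{P}_m$ is the set of $2^{m-1}$ paths from the origin visiting $m$ vertices: $(i,p_i)_{0\le i\le m-1}$, $p_0=0$, $|p_{i+1}-p_i|=1$; $\pi$ is uniform on $\mathcal{P}_m$. Exponential family: $F_0$ a nondegenerate distribution on $\mathbb{R}$ with $\varphi(\theta)=\mathbf{E}_{F_0}e^{\theta X}<\infty$ near $0$; $F_\theta$ has density $\exp(\theta x-\log\varphi(\theta))$ w.r.t. $F_0$. Under $H_0$ the $X_v$ are i.i.d. $F_0$; under $H_{1,m}$ with path $p$ they are independent, $F_{\theta_m}$ on $p$ ($\theta_m>0$) and $F_0$ off $p$. Tests are measurable $\{0,1\}$-valued functions of $(X_v)$. *)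

(* Defs.v *)
From HB Require Import structures.
From mathcomp Require Import all_boot all_order all_algebra.
From mathcomp Require Import all_classical all_reals all_analysis.
Unset Printing Implicit Defensive.
Import Order.TTheory GRing.Theory Num.Theory.
Local Open Scope classical_set_scope.
Local Open Scope ring_scope.

(* A vertex (i,j) with 0 <= i <= m-1 and |j| <= m is encoded as a pair
   (i, k) : 'I_m * 'I_(2m+1) with j = k - m. *)
Definition jval (m : nat) (k : 'I_(2 * m).+1) : int := (k%:Z - m%:Z)%R.

Definition in_lattice (m : nat) (v : 'I_m * 'I_(2 * m).+1) : bool :=
  [&& (- (v.1 : nat)%:Z <= jval m v.2)%R, (jval m v.2 <= (v.1 : nat)%:Z)%R
    & (2 %| (jval m v.2 - (v.1 : nat)%:Z))%Z].

Definition vtx (m : nat) := {v : 'I_m * 'I_(2 * m).+1 | in_lattice m v}.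

(* A path is p : 'I_m -> (encoded) j-coordinate, i.e. the vertex sequence
   (i, p_i)_{0 <= i <= m-1}, with p_0 = 0 and |p_{i+1} - p_i| = 1. *)
Definition is_lpath (m : nat) (p : {ffun 'I_m -> 'I_(2 * m).+1}) : bool :=
  [forall i : 'I_m, ((i : nat) == 0%N) ==> (jval m (p i) == 0%R)] &&
  [forall i : 'I_m, forall i' : 'I_m, ((i' : nat) == i.+1) ==>
     (`|jval m (p i') - jval m (p i)|%R == 1%R)].

Definition Paths (m : nat) : {set {ffun 'I_m -> 'I_(2 * m).+1}} :=
  [set p | is_lpath m p].

Definition on_path (m : nat) (p : {ffun 'I_m -> 'I_(2 * m).+1}) (v : vtx m) : bool :=
  p (val v).1 == (val v).2.

Section Space.
Variable R : realType.

Definition coord_sets (m : nat) : set (set (vtx m -> R)) :=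
  \bigcup_(v in [set: vtx m])
    preimage_set_system [set: vtx m -> R] (fun x => x v) (@measurable _ R).

Definition measurable_test (m : nat) (T : (vtx m -> R) -> bool) : Prop :=
  smallest (sigma_algebra [set: vtx m -> R]) (coord_sets m) (T @^-1` [set true]).

Definition upd (m : nat) (x : vtx m -> R) (v : vtx m) (y : R) : vtx m -> R :=
  fun w => if w == v then y else x w.

Variable F0 : probability R R.

Definition mgf (t : R) : R := fine (\int[F0]_x (expR (t * x))%:E)%E.

Definition mgf_finite (t : R) : Prop :=
  F0.-integrable [set: R] (fun x => (expR (t * x))%:E).

Definition expfam_density (t : R) (x : R) : R := expR (t * x - ln (mgf t)).

(* Product measure of independent coordinates, coordinate v having law
   with density (w v) w.r.t. F0, defined by iterated integration over the
   list of vertices l; the integrand f is evaluated at a point whose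
   coordinates in l have been integrated out. *)
Fixpoint iint (m : nat) (l : seq (vtx m)) (w : vtx m -> R -> R)
    (f : (vtx m -> R) -> \bar R) (x : vtx m -> R) : \bar R :=
  match l with
  | [::] => f x
  | v :: l' => (\int[F0]_y ((w v y)%:E * iint m l' w f (upd m x v y)))%E
  end.

Definition prodP (m : nat) (w : vtx m -> R -> R) (A : set (vtx m -> R)) : \bar R :=
  iint m (enum {: vtx m}) w (fun x => (\1_A x)%:E) (fun _ => 0).

Definition w_null (m : nat) : vtx m -> R -> R := fun _ _ => 1.
Definition w_alt (m : nat) (t : R) (p : {ffun 'I_m -> 'I_(2 * m).+1}) :
  vtx m -> R -> R :=
  fun v y => if on_path m p v then expfam_density t y else 1.

Definition bayes_risk (t : R) (m : nat) : \bar R :=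
  ereal_inf [set r | exists T : (vtx m -> R) -> bool, measurable_test m T /\
    r = (prodP m (w_null m) (T @^-1` [set true]) +
         \sum_(p in Paths m) ((#|Paths m|%:R)^-1)%:E *
             prodP m (w_alt m t p) (T @^-1` [set false]))%E].

End Space.

Arguments measurable_test {R} m T.
Arguments upd {R} m x v y.
Arguments mgf {R} F0 t.
Arguments mgf_finite {R} F0 t.
Arguments expfam_density {R} F0 t x.
Arguments iint {R} F0 m l w f x.
Arguments prodP {R} F0 m w A.
Arguments w_null {R} m _ _.
Arguments w_alt {R} F0 m t p _ _.
Arguments bayes_risk {R} F0 t m.

Definition nondegenerate_law (R : realType) (F0 : probability R R) : Prop :=
  forall c : R, (F0 [set c] < 1)%E.

Definition mgf_finite_near0 (R : realType) (F0 : probability R R) : Prop :=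
  exists e : R, 0 < e /\ forall t : R, `|t| < e -> mgf_finite F0 t.

Arguments nondegenerate_law {R} F0.
Arguments mgf_finite_near0 {R} F0.

(* Main.v *)
(* If theta m^(1/4) -> 0: the likelihood ratio L has null second moment
   E (1 + x)^N, where N is the number of common vertices of two independent
   uniform paths and x = O(theta^2); as N is of order sqrt m this tends to 1, so
   L -> 1 in L^2 and the risk tends to 1.

   If theta m^(1/4) -> oo: with high probability the path stays mostly in the
   band |j| <= K sqrt m, which has O(m^(3/2)) vertices.  Exceedances of a fixed
   level a over that band are counted; thresholding makes the variances bounded
   whatever theta is, the mean shift is m delta with delta of order min(theta, 1),
   and m delta beats the standard deviation m^(3/4).  An exponential weighting of
   the count replaces Chebyshev's inequality, so that every expectation is a
   product over the vertices. *)
Require Import Defs.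
From HB Require Import structures.
From mathcomp Require Import all_boot all_order all_algebra.
From mathcomp Require Import all_classical all_reals all_analysis.
From mathcomp Require Import measurable_realfun zify ring lra.
Import Order.TTheory GRing.Theory Num.Theory.
Local Open Scope classical_set_scope.
Local Open Scope ring_scope.

(** * Iterated integrals as positive functionals *)

(** Laws of the whole sample exist only as iterated integrals, so no product measure is built.
    [iint] serves as a functional that is monotone and additive on nonnegative measurable functions
    and multiplicative on products over vertices; [iint_density] links null and alternative. This
    shapes both halves: the test bounds involve only a product statistic and its inverse, and the
    L^2 argument is arranged so that nothing is ever subtracted under an integral.

    Meetings of two paths are controlled without a local limit theorem: a supersolution of the
    one-step recursion, with a kink of slope of order [m^(-1/2)], bounds [E (1 + x)^N] once
    [x * m^(1/2)] is small. As [x] is of order [theta^2], this is the threshold for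
    [theta * m^(1/4)].

    For the test, with a band of half-width [L = K sqrt m], the mean of the inverse statistic along
    a good path has exponent at most [6 lam^2 m L - lam del m / 2], whose minimum over [lam] is of
    order [- del^2 m / L], that is [- (del * m^(1/4))^2 / K]. The shift [del] stays below 1 however
    large [theta] is, so [m^(1/4)] has to be large as well as [theta * m^(1/4)]. *)

(* The function type [vtx m -> R] is not canonically pointed, hence this alias
   carrying the sigma-algebra of [measurable_test]. *)
Definition sample (R : realType) (m : nat) : Type := vtx m -> R.
HB.instance Definition _ R m := gen_eqMixin (sample R m).
HB.instance Definition _ R m := gen_choiceMixin (sample R m).
HB.instance Definition _ R m := isPointed.Build (sample R m) (fun _ => 0).
Definition sampleM (R : realType) (m : nat) : measurableType _ :=
  @g_sigma_algebraType (sample R m) (coord_sets R m).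

Section IteratedIntegral.
Context (R : realType) (F0 : probability R R) (m : nat).

Notation S := (sampleM R m).

Lemma measurable_coord (v : vtx m) : measurable_fun [set: S] (fun x : S => x v).
Proof.
move=> _ Y mY; rewrite setTI; apply: sub_sigma_algebra.
by exists v => //; exists Y => //; rewrite setTI.
Qed.

Lemma measurable_upd (v : vtx m) :
  measurable_fun [set: S * R] (fun z : S * R => upd m z.1 v z.2 : S).
Proof.
apply: (@measurability _ _ (S * R)%type S setT _ (coord_sets R m)) => //.
move=> A [_ [u _ [B mB <-]] <-].
rewrite !setTI.
have -> : (fun z : S * R => upd m z.1 v z.2) @^-1` ((fun x => x u) @^-1` B) =
  (fun z : S * R => if u == v then z.2 else z.1 u) @^-1` B by [].
rewrite -[X in measurable X]setTI; case: (u == v).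
  exact: (@measurable_snd _ _ S R).
exact: (measurableT_comp (measurable_coord u) (@measurable_fst _ _ S R)).
Qed.

Definition mfun_ge0 (f : S -> \bar R) : Prop :=
  measurable_fun [set: S] f /\ (forall x, 0 <= f x)%E.

Definition weight (w : vtx m -> R -> R) : Prop :=
  forall v, measurable_fun [set: R] (w v) /\ (forall y, 0 <= w v y).

Lemma measurable_section f (x : S) v : mfun_ge0 f ->
  measurable_fun [set: R] (fun y => f (upd m x v y)).
Proof.
move=> [mf _]; apply: (measurableT_comp mf).
exact: (measurableT_comp (measurable_upd v) (pair1_measurable (x : S))).
Qed.

(** The one appeal to Tonelli: as [upd] is jointly measurable in the point and the new value, each
    partial integral is measurable in the other coordinates. *)
Lemma mfun_ge0_iint l w f : weight w -> mfun_ge0 f -> mfun_ge0 (iint F0 m l w f).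
Proof.
move=> ww mf; elim: l => //= v l [mg g0]; split; last first.
  move=> x; apply: integral_ge0 => y _.
  by rewrite mule_ge0 ?lee_fin ?(ww v).2.
apply: (@measurable_fun_fubini_tonelli_F _ _ S R R F0
  (fun z : S * R => (w v z.2)%:E * iint F0 m l w f (upd m z.1 v z.2))%E).
  apply: emeasurable_funM.
    apply/measurable_EFinP.
    exact: (measurableT_comp (ww v).1 (@measurable_snd _ _ S R)).
  exact: (measurableT_comp mg (measurable_upd v)).
by move=> z; rewrite mule_ge0 ?lee_fin ?(ww v).2.
Qed.

Lemma measurable_iint_slice l w f (x : S) v : weight w -> mfun_ge0 f ->
  measurable_fun [set: R] (fun y => (w v y)%:E * iint F0 m l w f (upd m x v y))%E.
Proof.
move=> ww mf; apply: emeasurable_funM.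
  by apply/measurable_EFinP; exact: (ww v).1.
by apply: measurable_section; exact: mfun_ge0_iint.
Qed.

Lemma iint_slice_ge0 l w f (x : S) v y : weight w -> mfun_ge0 f ->
  (0 <= (w v y)%:E * iint F0 m l w f (upd m x v y))%E.
Proof.
move=> ww mf; rewrite mule_ge0 ?lee_fin ?(ww v).2//.
exact: (mfun_ge0_iint l w f ww mf).2.
Qed.

Lemma le_iint l w f g x : weight w -> mfun_ge0 f -> mfun_ge0 g ->
  (forall x, f x <= g x)%E -> (iint F0 m l w f x <= iint F0 m l w g x)%E.
Proof.
move=> ww mf mg fg; elim: l x => //= v l IH x.
apply: ge0_le_integral => //.
- by move=> y _; exact: iint_slice_ge0.
- exact: measurable_iint_slice.
- exact: measurable_iint_slice.
- by move=> y _; rewrite lee_wpmul2l ?lee_fin ?(ww v).2.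
Qed.

Lemma eq_iint l w f g x : f =1 g -> iint F0 m l w f x = iint F0 m l w g x.
Proof. by move=> /funext ->. Qed.

Lemma mfun_ge0D f g : mfun_ge0 f -> mfun_ge0 g -> mfun_ge0 (fun x => f x + g x)%E.
Proof.
move=> [mf f0] [mg g0]; split; first exact: emeasurable_funD.
by move=> x; rewrite adde_ge0.
Qed.

Lemma mfun_ge0M f g : mfun_ge0 f -> mfun_ge0 g -> mfun_ge0 (fun x => f x * g x)%E.
Proof.
move=> [mf f0] [mg g0]; split; first exact: emeasurable_funM.
by move=> x; rewrite mule_ge0.
Qed.

Lemma mfun_ge0_cst (c : R) : 0 <= c -> mfun_ge0 (fun=> c%:E).
Proof. by move=> c0; split => // x; rewrite lee_fin. Qed.

Lemma mfun_ge0_sum (I : Type) (s : seq I) (f : I -> S -> \bar R) :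
  (forall i, mfun_ge0 (f i)) -> mfun_ge0 (fun x => \sum_(i <- s) f i x)%E.
Proof.
move=> mf; split; first by apply: emeasurable_sum => i; exact: (mf i).1.
by move=> x; apply: sume_ge0 => i _; exact: (mf i).2.
Qed.

Lemma iintD l w f g x : weight w -> mfun_ge0 f -> mfun_ge0 g ->
  iint F0 m l w (fun x => f x + g x)%E x =
  (iint F0 m l w f x + iint F0 m l w g x)%E.
Proof.
move=> ww mf mg; elim: l x => //= v l IH x.
rewrite -ge0_integralD//; last 4 first.
- by move=> y _; exact: iint_slice_ge0.
- exact: measurable_iint_slice.
- by move=> y _; exact: iint_slice_ge0.
- exact: measurable_iint_slice.
apply: eq_integral => y _; rewrite IH ge0_muleDr//.
  exact: (mfun_ge0_iint l w f ww mf).2.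
exact: (mfun_ge0_iint l w g ww mg).2.
Qed.

Lemma iintZl l w (c : R) f x : weight w -> 0 <= c -> mfun_ge0 f ->
  iint F0 m l w (fun x => c%:E * f x)%E x = (c%:E * iint F0 m l w f x)%E.
Proof.
move=> ww c0 mf; elim: l x => //= v l IH x.
rewrite -ge0_integralZl_EFin//; last 2 first.
- by move=> y _; exact: iint_slice_ge0.
- exact: measurable_iint_slice.
by apply: eq_integral => y _; rewrite IH muleCA.
Qed.

Lemma iint0 l w x : iint F0 m l w (fun=> 0%E) x = 0%E.
Proof.
elim: l x => //= v l IH x.
under eq_integral do rewrite IH mule0.
exact: integral0.
Qed.

Lemma iint_sum (I : Type) (s : seq I) (f : I -> S -> \bar R) l w x :
  weight w -> (forall i, mfun_ge0 (f i)) ->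
  iint F0 m l w (fun x => \sum_(i <- s) f i x)%E x =
  (\sum_(i <- s) iint F0 m l w (f i) x)%E.
Proof.
move=> ww mf; elim: s => [|i s IH].
  rewrite big_nil -[RHS](iint0 l w x); apply: eq_iint => y.
  by rewrite big_nil.
rewrite big_cons -IH -iintD//; last exact: mfun_ge0_sum.
by apply: eq_iint => y; rewrite big_cons.
Qed.

(** Independence in the form used everywhere below: since [l] has no repetition, each integration
    meets exactly one factor, and the others are constant in its variable. *)
Lemma iint_prod l w (h : vtx m -> R -> R) (c : vtx m -> R) x :
  weight w -> weight h -> uniq l ->
  (forall v, \int[F0]_y (w v y * h v y)%:E = (c v)%:E)%E ->
  iint F0 m l w (fun x => (\prod_v h v (x v))%:E) x =
  (\prod_(v in l) c v * \prod_(v | v \notin l) h v (x v))%:E.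
Proof.
move=> ww wh + wc; elim: l x => [|v l IH] x /=.
  have -> : \prod_(v in [::]) c v = 1 by rewrite big_pred0.
  by move=> _; rewrite mul1r; congr EFin; apply: eq_bigl => v.
move=> /andP[vl ul].
pose K := \prod_(u in l) c u * \prod_(u | u \notin v :: l) h u (x u).
have c0 u : 0 <= c u.
  rewrite -lee_fin -wc integral_ge0// => y _.
  by rewrite lee_fin mulr_ge0 ?(ww u).2 ?(wh u).2.
have K0 : 0 <= K.
  apply: mulr_ge0; apply: prodr_ge0 => u _ //; exact: (wh u).2.
transitivity (\int[F0]_y (K%:E * (w v y * h v y)%:E))%E.
  apply: eq_integral => y _; rewrite IH//.
  rewrite -!EFinM; congr EFin.
  rewrite [\prod_(_ | _ \notin l) _](bigD1 v)//= /K.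
  have -> : upd m x v y v = y by rewrite /upd eqxx.
  have -> : \prod_(i | (i \notin l) && (i != v)) h i (upd m x v y i) =
    \prod_(u | u \notin v :: l) h u (x u).
    apply: eq_big => u; first by rewrite inE negb_or andbC.
    by move=> /andP[_ /negbTE uv]; rewrite /upd uv.
  by ring.
rewrite ge0_integralZl_EFin//; last 2 first.
- by move=> y _; rewrite lee_fin mulr_ge0 ?(ww v).2 ?(wh v).2.
- by apply/measurable_EFinP/measurable_funM; [exact: (ww v).1|exact: (wh v).1].
rewrite wc -EFinM; congr EFin; rewrite /K.
rewrite [in RHS](bigD1 v)/= ?inE ?eqxx//.
have -> : \prod_(i | (i \in v :: l) && (i != v)) c i = \prod_(u in l) c u.
  apply: eq_bigl => u; rewrite inE; case: eqVneq => //= [->|_].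
    by rewrite (negbTE vl).
  by rewrite andbT.
by ring.
Qed.

Lemma mfun_ge0_prod (s : seq (vtx m)) (h : vtx m -> R -> R) : weight h ->
  mfun_ge0 (fun x => (\prod_(v <- s) h v (x v))%:E).
Proof.
move=> wh; split; last first.
  by move=> x; rewrite lee_fin prodr_ge0// => v _; exact: (wh v).2.
apply/measurable_EFinP.
apply: (@measurable_prod _ S R setT _ _ (fun v (x : S) => h v (x v))) => v _.
exact: (measurableT_comp (wh v).1 (measurable_coord v)).
Qed.

Lemma iint_coordM l w (k : R -> R) f x v : weight w -> mfun_ge0 f ->
  (forall y, 0 <= k y) -> v \notin l ->
  iint F0 m l w (fun x => (k (x v))%:E * f x)%E x = ((k (x v))%:E * iint F0 m l w f x)%E.
Proof.
move=> ww mf k0; elim: l x => //= u l IH x; rewrite inE negb_or => /andP[vu vl].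
rewrite -ge0_integralZl_EFin//; last 2 first.
- by move=> y _; exact: iint_slice_ge0.
- exact: measurable_iint_slice.
by apply: eq_integral => y _; rewrite IH// /upd (negbTE vu) muleCA.
Qed.

Lemma weight1 : weight (@w_null R m).
Proof. by move=> v; split => [|y]; [exact: measurable_cst|exact: ler01]. Qed.

(** Change of measure to the null. Weights enter the integrand one vertex at a time; [uniq l] keeps
    the coordinate [v] fixed while the later vertices are integrated, so [iint_coordM] applies to
    its factor. *)
Lemma iint_density l w f x : weight w -> mfun_ge0 f -> uniq l ->
  iint F0 m l w f x =
  iint F0 m l (w_null m) (fun x => (\prod_(v <- l) w v (x v))%:E * f x)%E x.
Proof.
move=> ww mf; elim: l x => [|v l IH] x /=; first by rewrite big_nil mul1e.
move=> /andP[vl ul].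
have mW := mfun_ge0_prod l w ww.
apply: eq_integral => y _; rewrite mul1e IH//.
transitivity (iint F0 m l (w_null m) (fun x => (w v (x v))%:E *
    ((\prod_(v <- l) w v (x v))%:E * f x))%E (upd m x v y)).
  rewrite iint_coordM//; first by rewrite /upd eqxx.
  - exact: weight1.
  - exact: mfun_ge0M.
  - exact: (ww v).2.
by apply: eq_iint => z; rewrite big_cons EFinM muleA.
Qed.

End IteratedIntegral.

(** * Uniform lattice paths *)

Definition step (b : bool) : int := if b then 1 else -1.

Fixpoint walk (d : int) (s : seq bool) : seq int :=
  d :: if s is b :: s' then walk (d + step b) s' else [::].

(** Listing by first step gives the recursion [big_bseqsS], on which [walk_sqr_sum] and
    [walk_meet_sum] are proved by induction with a free starting point. *)
Fixpoint bseqs (n : nat) : seq (seq bool) :=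
  if n is n'.+1 then map (cons true) (bseqs n') ++ map (cons false) (bseqs n')
  else [:: [::]].

Lemma big_bseqsS (V : nmodType) n (F : seq bool -> V) :
  \sum_(s <- bseqs n.+1) F s =
  \sum_(s <- bseqs n) F (true :: s) + \sum_(s <- bseqs n) F (false :: s).
Proof. by rewrite /= big_cat !big_map. Qed.

Lemma mem_bseqs n s : (s \in bseqs n) = (size s == n).
Proof.
elim: n s => [|n IH] [|b s] //=.
  by rewrite mem_cat; apply/negbTE/norP; split; apply/mapP => -[].
rewrite mem_cat eqSS -IH; case: b.
  rewrite (mem_map (f := cons true)); last by move=> ? ? [].
  by rewrite orbC; case: mapP => // -[].
rewrite orbC (mem_map (f := cons false)); last by move=> ? ? [].
by rewrite orbC; case: mapP => // -[].
Qed.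

Lemma bseqs_uniq n : uniq (bseqs n).
Proof.
elim: n => //= n IH; rewrite cat_uniq !map_inj_uniq ?IH ?andbT//=; try by move=> ? ? [].
by apply/hasPn => _ /mapP[s _ ->]; apply/mapP => -[].
Qed.

Lemma size_bseqs n : size (bseqs n) = (2 ^ n)%N.
Proof. by elim: n => //= n IH; rewrite size_cat !size_map IH expnS mul2n addnn. Qed.

Lemma size_walk d s : size (walk d s) = (size s).+1.
Proof. by elim: s d => //= b s IH d; rewrite IH. Qed.

Lemma walk_inj d : injective (walk d).
Proof.
move=> s; elim: s d => [|b s IH] d [|c t] //= [E].
- by move: E; case: (t).
- by move: E; case: (s).
have bc : b = c.
  by move: E; case: (s) (t) => [|? ?] [|? ?] /= [] /addrI; case: b; case: c.
by rewrite -bc in E *; rewrite (IH _ _ E).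
Qed.

Lemma nth_walk_bound d s i : (i <= size s)%N ->
  (`|nth 0 (walk d s) i - d| <= i%:Z) && (2 %| nth 0 (walk d s) i - d - i%:Z)%Z.
Proof.
elim: s d i => [|b s IH] d [|i] //= h; rewrite ?subrr ?normr0//.
have {IH h} := IH (d + step b) i h; case: b => /=; set z := nth _ _ _; lia.
Qed.

Lemma nth_walkS d s i : (i < size s)%N ->
  nth 0 (walk d s) i.+1 = nth 0 (walk d s) i + step (nth false s i).
Proof.
elim: s d i => [|b s IH] d [|i] //= h; last exact: IH.
by case: (s).
Qed.

Lemma nth_walk0 d s : nth 0 (walk d s) 0 = d.
Proof. by case: s. Qed.

(** The shift by [n.+1] undoes the one in [jval]. For [size s = n] the walk stays within distance
    [n] of 0, so [inord] never falls back on its default. *)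
Definition path_of (n : nat) (s : seq bool) : {ffun 'I_n.+1 -> 'I_(2 * n.+1).+1} :=
  [ffun i : 'I_n.+1 => inord (absz (nth 0 (walk 0 s) i + n.+1%:Z))].

Lemma jval_path_of n s i : size s = n ->
  jval n.+1 (path_of n s i) = nth 0 (walk 0 s) i.
Proof.
move=> sn; rewrite /jval ffunE.
have := @nth_walk_bound 0 s i; rewrite sn -ltnS ltn_ord => /(_ isT).
set z := nth _ _ _; have := ltn_ord i => h /andP[h1 h2].
rewrite inordK; lia.
Qed.

Lemma jval_inj m : injective (jval m).
Proof. by move=> i j; rewrite /jval => h; apply: val_inj => /=; lia. Qed.

Lemma path_of_eq n s t i : size s = n -> size t = n ->
  (path_of n s i == path_of n t i) = (nth 0 (walk 0 s) i == nth 0 (walk 0 t) i).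
Proof.
by move=> sn tn; rewrite -!(@jval_path_of n)// (inj_eq (@jval_inj _)).
Qed.

Lemma path_of_in n s : size s = n -> path_of n s \in Paths n.+1.
Proof.
move=> sn; rewrite inE; apply/andP; split.
  apply/forallP => i; apply/implyP => /eqP i0.
  by rewrite jval_path_of// i0 nth_walk0.
apply/forallP => i; apply/forallP => j; apply/implyP => /eqP ji.
rewrite !jval_path_of// ji nth_walkS ?sn//; last by have := ltn_ord j; rewrite ji.
rewrite addrAC subrr add0r; by case: nth.
Qed.

Lemma path_of_inj n s t : size s = n -> size t = n ->
  path_of n s = path_of n t -> s = t.
Proof.
move=> sn tn e; apply: (@walk_inj 0); apply: (@eq_from_nth _ 0).
  by rewrite !size_walk sn tn.
move=> i; rewrite size_walk sn => h.
by apply/eqP; rewrite -(path_of_eq n s t (Ordinal h))// e.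
Qed.

Lemma path_of_surj n p : p \in Paths n.+1 ->
  exists2 s, size s = n & p = path_of n s.
Proof.
rewrite inE => /andP[/forallP p0 /forallP pS].
pose z (i : nat) : int := jval n.+1 (p (inord i)).
pose s := mkseq (fun i => z i < z i.+1) n.
have sn : size s = n by rewrite size_mkseq.
exists s => //; apply/ffunP => i; apply: (@jval_inj n.+1).
rewrite jval_path_of//.
suff H k : (k <= n)%N -> z k = nth 0 (walk 0 s) k.
  by rewrite -H ?/z ?inord_val// -ltnS.
elim: k => [_|k IH kn].
  by rewrite nth_walk0; apply/eqP/(implyP (p0 _)); rewrite /= inordK.
rewrite nth_walkS ?sn// nth_mkseq// -IH 1?ltnW//.
have /forallP/(_ (inord k.+1))/implyP := pS (inord k).
rewrite !inordK ?ltnS// 1?ltnW// eqxx => /(_ isT).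
rewrite -/(z k) -/(z k.+1); case: ltP => /=; lia.
Qed.

Lemma perm_Paths n : perm_eq (enum (Paths n.+1)) (map (path_of n) (bseqs n)).
Proof.
apply: uniq_perm.
- exact: enum_uniq.
- rewrite map_inj_in_uniq ?bseqs_uniq// => s t.
  by rewrite !mem_bseqs => /eqP sn /eqP tn; exact: path_of_inj.
move=> p; rewrite mem_enum; apply/idP/mapP.
  by move=> /path_of_surj[s sn ->]; exists s => //; rewrite mem_bseqs sn.
by move=> [s]; rewrite mem_bseqs => /eqP sn ->; exact: path_of_in.
Qed.

Lemma big_Paths (V : nmodType) n (G : _ -> V) :
  \sum_(p in Paths n.+1) G p = \sum_(s <- bseqs n) G (path_of n s).
Proof. by rewrite -big_enum/= (perm_big _ (perm_Paths n))/= big_map. Qed.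

Lemma card_Paths n : #|Paths n.+1| = (2 ^ n)%N.
Proof. by rewrite cardE (perm_size (perm_Paths n)) size_map size_bseqs. Qed.

Lemma Paths_in_lattice n p i : p \in Paths n.+1 -> in_lattice n.+1 (i, p i).
Proof.
move=> /path_of_surj[s sn ->]; rewrite /in_lattice /= jval_path_of//.
have := @nth_walk_bound 0 s i; rewrite sn -ltnS ltn_ord => /(_ isT).
set z := nth _ _ _; lia.
Qed.

(** * Second moment and meetings of uniform walks *)

Section Bounds.
Context (R : realFieldType).

Lemma sum_bseqs_cst n (c : R) : \sum_(s <- bseqs n) c = 2 ^+ n * c.
Proof. by rewrite big_const_seq count_predT iter_addr addr0 size_bseqs -natrX mulr_natl. Qed.

(** The mean of [(d + 1)^2] and [(d - 1)^2] is [d^2 + 1], so the mean square at time [i] is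
    [d^2 + i], bounded here by [d^2 + n] at each of the [n.+1] times. It serves to show that few
    paths spend long outside the band. *)
Lemma walk_sqr_sum n d :
  \sum_(s <- bseqs n) \sum_(z <- walk d s) (z%:~R : R) ^+ 2 <=
  2 ^+ n * n.+1%:R * (d%:~R ^+ 2 + n%:R).
Proof.
elim: n d => [|n IH] d.
  by rewrite big_seq1/= big_seq1 expr0 !mul1r addr0.
rewrite big_bseqsS /= -/walk.
under eq_bigr do rewrite big_cons.
under [X in _ + X]eq_bigr do rewrite big_cons.
rewrite !big_split /= !sum_bseqs_cst [2 ^+ n.+1]exprS.
have := IH (d + 1); have := IH (d - 1).
rewrite -!/walk !intrD !mulrNz !mulr1z -![n.+1%:R]natr1 -![n.+2%:R]natr1 -![n.+1%:R]natr1.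
set A := \sum_(s <- _) _; set B := \sum_(s <- _) _.
have : (0 : R) <= 2 ^+ n by apply: exprn_ge0.
have : (0 : R) <= n%:R by [].
set t := 2 ^+ n; set D := d%:~R; set k := n%:R => k0 t0 HA HB.
have tk : 0 <= t * k by exact: mulr_ge0.
by nra.
Qed.

Variables (x eps beta : R).
Hypotheses (x0 : 0 <= x) (eps0 : 0 <= eps) (beta0 : 0 <= beta).

Definition meet_weight (a b : seq int) : R :=
  \prod_(z <- zip a b) (if z.1 == z.2 then 1 + x else 1).

(* Supersolution for the walk [D] given by the difference of two independent
   paths, whose steps are [0, 0, 2, -2]: the term linear in [n] absorbs the
   variance added to the square at each step, and the kink of [|D|] at [0] pays
   for the factor [1 + x] collected at each meeting. *)
Definition barrier (n : nat) (D : int) : R :=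
  1 + eps * (1 - beta * `|D%:~R| / 2) ^+ 2 + n%:R * (eps * beta ^+ 2 / 2).

Lemma barrier_ge1 n D : 1 <= barrier n D.
Proof.
rewrite /barrier -addrA lerDl addr_ge0// mulr_ge0 ?sqr_ge0//.
by rewrite divr_ge0// mulr_ge0// sqr_ge0.
Qed.

Lemma barrier_super n D (f := if D == 0 then 1 + x else 1) :
  x * (1 + eps + n.+1%:R * (eps * beta ^+ 2 / 2)) <= eps * beta ->
  f * (2 * barrier n D + barrier n (D + 2) + barrier n (D - 2)) <=
  4 * barrier n.+1 D.
Proof.
rewrite /f /barrier -[n.+1%:R]natr1 !intrD !mulrNz.
set k := n%:R; have : 0 <= k by []; move: k => k k0.
set c := eps * beta ^+ 2 / 2.
have c0 : 0 <= c by rewrite divr_ge0// mulr_ge0// sqr_ge0.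
have cE : eps * beta ^+ 2 = 2 * c by rewrite /c; field.
case: eqVneq => [->|D0] H.
  (* With [c = eps * beta ^+ 2 / 2], the moves to [2] and [-2] lower the average of the square term
     by [eps * beta - c]. The [c] is made up by the extra step in the linear term, and the
     hypothesis says that [eps * beta] covers [x] times the value at 0. *)
  rewrite normr0 mulr0 mul0r subr0 expr1n !add0r normrN.
  have -> : `|2%:~R| = 2 :> R by rewrite ger0_norm.
  have -> : eps * (1 - beta * 2 / 2) ^+ 2 = eps - 2 * (eps * beta) + 2 * c.
    by rewrite -cE; field.
  have xe : 0 <= x * (eps * beta) by rewrite mulr_ge0// mulr_ge0.
  have xc : 0 <= x * c by exact: mulr_ge0.
  by nra.
(* Away from 0 there is no factor. The quadratic part rises on average by exactly [c], which the
   linear term supplies, and the part in [- |D|] can only fall, by the triangle inequality [T]. *)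
rewrite mul1r; set d : R := D%:~R.
have E (y : R) : eps * (1 - beta * `|y| / 2) ^+ 2 =
    eps - eps * beta * `|y| + c * y ^+ 2 / 2.
  by rewrite -(real_normK (num_real y)) /c; field.
rewrite !E.
have T : 2 * `|d| <= `|d + 2%:~R| + `|d - 2%:~R|.
  rewrite -[2]ger0_norm// -normrM; apply: le_trans (ler_normD _ _).
  by rewrite le_eqVlt; apply/orP; left; apply/eqP; congr `| _ |; ring.
have eb : 0 <= eps * beta by exact: mulr_ge0.
have := ler_wpM2l eb T.
move: (`|d|) (`|d + _|) (`|d - _|) => a1 a2 a3.
have -> : (2%:~R : R) = 2 by [].
by nra.
Qed.

(** Splitting off the first step of both walks moves [d - e] by 0, 0, 2 or -2, so [barrier_super]
    closes the induction. The barrier has index [n.+1] because [n] steps visit [n.+1] vertices; [N]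
    provides one hypothesis valid at all stages. *)
Lemma walk_meet_sum N n d e :
  x * (1 + eps + N%:R * (eps * beta ^+ 2 / 2)) <= eps * beta -> (n < N)%N ->
  \sum_(s <- bseqs n) \sum_(t <- bseqs n) meet_weight (walk d s) (walk e t) <=
  4 ^+ n * barrier n.+1 (d - e).
Proof.
move=> H; have HN k : (k < N)%N ->
    x * (1 + eps + k.+1%:R * (eps * beta ^+ 2 / 2)) <= eps * beta.
  move=> kN; apply: le_trans H; apply: ler_wpM2l => //.
  rewrite lerD2l; apply: ler_wpM2r; last by rewrite ler_nat.
  by rewrite divr_ge0// mulr_ge0// sqr_ge0.
pose f := if d - e == 0 then 1 + x else 1.
elim: n d e @f => [|n IH] d e f nN.
  (* One vertex is left, hence one factor [f]. As all barriers are at least 1, the supersolution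
     inequality already yields [f <= barrier 1 (d - e)]. *)
  have := @barrier_super 0 (d - e) (HN _ nN).
  rewrite !big_seq1 /meet_weight/= big_seq1/= -[d == e]subr_eq0 -/f expr0 mul1r.
  have f0 : 0 <= f by rewrite /f; case: ifP => // _; rewrite addr_ge0.
  have := barrier_ge1 0 (d - e); have := barrier_ge1 0 (d - e + 2).
  have := barrier_ge1 0 (d - e - 2).
  by nra.
have f0 : 0 <= f by rewrite /f; case: ifP => // _; rewrite addr_ge0.
have mE b c s t : meet_weight (walk d (b :: s)) (walk e (c :: t)) =
    f * meet_weight (walk (d + step b) s) (walk (e + step c) t).
  by rewrite /meet_weight /= big_cons/= /f subr_eq0.
have mS b c : \sum_(s <- bseqs n) \sum_(t <- bseqs n)
      meet_weight (walk d (b :: s)) (walk e (c :: t)) =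
    f * \sum_(s <- bseqs n) \sum_(t <- bseqs n)
      meet_weight (walk (d + step b) s) (walk (e + step c) t).
  rewrite mulr_sumr; apply: eq_bigr => s _; rewrite mulr_sumr.
  by apply: eq_bigr => t _; rewrite mE.
have two (F : seq bool -> seq bool -> R) :
    \sum_(s <- bseqs n.+1) \sum_(t <- bseqs n.+1) F s t =
    \sum_(s <- bseqs n) \sum_(t <- bseqs n) F (true :: s) (true :: t) +
    \sum_(s <- bseqs n) \sum_(t <- bseqs n) F (true :: s) (false :: t) +
    (\sum_(s <- bseqs n) \sum_(t <- bseqs n) F (false :: s) (true :: t) +
    \sum_(s <- bseqs n) \sum_(t <- bseqs n) F (false :: s) (false :: t)).
  by rewrite big_bseqsS; congr (_ + _); rewrite -big_split;
    apply: eq_bigr => s _; rewrite big_bseqsS.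
rewrite two !mS -!mulrDr.
have nN' := ltnW nN.
have := IH (d + 1) (e + 1) nN'; have := IH (d + 1) (e - 1) nN'.
have := IH (d - 1) (e + 1) nN'; have := IH (d - 1) (e - 1) nN'.
have -> : d - 1 - (e - 1) = d - e by ring.
have -> : d - 1 - (e + 1) = d - e - 2 by ring.
have -> : d + 1 - (e - 1) = d - e + 2 by ring.
have -> : d + 1 - (e + 1) = d - e by ring.
set A1 := \sum_(_ <- _) _; set A2 := \sum_(_ <- _) _.
set A3 := \sum_(_ <- _) _; set A4 := \sum_(_ <- _) _ => h1 h2 h3 h4.
have := @barrier_super n.+1 (d - e) (HN _ nN); rewrite -/f => K.
rewrite exprS -mulrA mulrCA.
apply: le_trans (ler_wpM2l (exprn_ge0 _ _) K) => //.
rewrite mulrCA; apply: ler_wpM2l => //.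
by lra.
Qed.

End Bounds.

(** * The exponential family *)

Section OneDim.
Context (R : realType) (F0 : probability R R).

(** Otherwise a level [a] with mass at or below it has no mass above any [b > a]. The supremum of
    the levels with null lower tail then carries all the mass, against nondegeneracy. *)
Lemma nondegenerate_split : nondegenerate_law F0 ->
  exists a e : R, [/\ 0 < e, (F0 `]a, +oo[%classic < 1)%E & (0 < F0 `](a + e)%R, +oo[%classic)%E].
Proof.
move=> nd; apply: contrapT => H.
have nul (A : set R) : measurable A -> F0 A = 0%E -> F0.-negligible A.
  by move=> mA A0; exact/negligibleP.
pose A := [set a : R | F0 `]-oo, a]%classic = 0%E].
have HA a b : ~ A a -> a < b -> F0 `]b, +oo[%classic = 0%E.
  move=> Aa ab; apply: contrapT => Fb; apply: H; exists a, (b - a).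
  rewrite subr_gt0 ab addrC subrK; split => //; last first.
    by rewrite lt0e measure_ge0 andbT; exact/eqP.
  rewrite ltNge; apply/negP => F1; apply: Aa; rewrite /A/=.
  have -> : `]-oo, a]%classic = ~` `]a, +oo[%classic :> set R by rewrite setCitvr.
  rewrite probability_setC//.
  have -> : F0 `]a, +oo[%classic = 1%E.
    by apply/eqP; rewrite eq_le F1 probability_le1.
  by rewrite subee.
have F0T : F0 [set: R] = 0%E -> False.
  by move=> h; have := @probability_setT _ _ _ F0; rewrite h => /esym/eqP; rewrite onee_eq0.
(* If [A] were empty there would be no mass above any [- k]; if unbounded, none below any [k].
   Either way the total mass would be 0. *)
have A_neq0 : A !=set0.
  apply/set0P/eqP => A0; apply: F0T; apply/negligibleP => //.
  have -> : [set: R] = \bigcup_k `](- k%:R), +oo[%classic.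
    apply/esym; rewrite -subTset => x _.
    exists (Num.truncn `|x|).+1 => //=; rewrite in_itv/= andbT ltrNl.
    apply: le_lt_trans (ler_norm _) _; rewrite normrN.
    by rewrite truncnS_gt.
  apply: negligible_bigcup => k; apply: nul => //.
  apply: (HA (- k%:R - 1)); last by rewrite ltrBlDr ltrDl.
  by rewrite -/(A _) A0.
have A_ub : has_ubound A.
  apply: contrapT => nub; apply: F0T; apply/negligibleP => //.
  have -> : [set: R] = \bigcup_k `]-oo, k%:R]%classic.
    apply/esym; rewrite -subTset => x _.
    exists (Num.truncn `|x|).+1 => //=; rewrite in_itv/=.
    by apply: le_trans (ler_norm _) _; rewrite ltW// truncnS_gt.
  apply: negligible_bigcup => k; apply: nul => //.
  have [a [Aa ka]] : exists a, A a /\ k%:R < a.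
    apply: contrapT => Hk; apply: nub; exists k%:R => a Aa.
    by rewrite leNgt; apply/negP => ka; apply: Hk; exists a.
  apply/eqP; rewrite eq_le measure_ge0 andbT -Aa le_measure ?inE//.
  by move=> x/=; rewrite !in_itv/= => /le_trans -> //; exact: ltW.
pose c := sup A.
suff : F0 (~` [set c]) = 0%E.
  move=> Fc; have := nd c; rewrite -[X in F0 X]setCK probability_setC ?Fc ?sube0 ?ltxx//.
  exact: measurableC.
apply/negligibleP; first exact: measurableC.
have -> : ~` [set c] =
    \bigcup_k (`]-oo, c - k.+1%:R^-1]%classic `|` `]c + k.+1%:R^-1, +oo[%classic).
  apply/seteqP; split => x /=.
    move=> /eqP xc; have xc0 : 0 < `|x - c| by rewrite normr_gt0 subr_eq0.
    exists (Num.truncn (`|x - c|^-1)) => //.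
    have : (Num.truncn `|x - c|^-1).+1%:R^-1 < `|x - c|.
      by rewrite invf_plt ?posrE// truncnS_gt.
    rewrite /= !in_itv/= andbT; set k := _^-1 => kx.
    have [h|h] := leP x c.
      by left; move: kx; rewrite ler0_norm ?subr_le0//; lra.
    by right; move: kx; rewrite gtr0_norm ?subr_gt0//; lra.
  move=> [k _]; have : 0 < k.+1%:R^-1 :> R by [].
  move=> k0 /= []; rewrite in_itv/= ?andbT => h xc; move: h; rewrite xc.
    by rewrite leNgt ltrBlDr ltrDl k0.
  by rewrite ltNge lerDl ltW.
apply: negligible_bigcup => k; apply: negligibleU; apply: nul => //.
  have [a Aa ca] : exists2 a, A a & c - k.+1%:R^-1 < a.
    by apply: sup_adherent.
  apply/eqP; rewrite eq_le measure_ge0 andbT -Aa le_measure ?inE//.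
  by move=> x/=; rewrite !in_itv/= => /le_trans -> //; exact: ltW.
have k0 : 0 < k.+1%:R^-1 :> R by [].
apply: (HA (c + k.+1%:R^-1 / 2)); last first.
  by rewrite ltrD2l ltr_pdivrMr// ltr_pMr// ltr1n.
move=> Ac; have : c + k.+1%:R^-1 / 2 <= c by exact: ub_le_sup.
by rewrite leNgt ltrDl divr_gt0.
Qed.

Definition two_val (a u v : R) (y : R) : R := if a < y then u else v.

Lemma measurable_two_val a u v : measurable_fun [set: R] (two_val a u v).
Proof.
by apply: measurable_fun_ifT => //; apply: measurable_fun_ltr.
Qed.


Lemma two_val_ge0 a u v y : 0 <= u -> 0 <= v -> 0 <= two_val a u v y.
Proof. by move=> u0 v0; rewrite /two_val; case: ifP. Qed.

Lemma integral_two_val10 a : (\int[F0]_y (two_val a 1 0 y)%:E = F0 `]a, +oo[%classic)%E.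
Proof.
rewrite -[X in _ = F0 X]setIT -integral_indic//.
apply: eq_integral => y _; rewrite /two_val indicE mem_setE in_itv/= andbT.
by case: ifP.
Qed.

Lemma integral_fin (g h : R -> R) : measurable_fun [set: R] g ->
  measurable_fun [set: R] h -> (forall y, 0 <= g y <= h y) ->
  (\int[F0]_y (h y)%:E < +oo)%E ->
  (\int[F0]_y (g y)%:E = (fine (\int[F0]_y (g y)%:E))%:E)%E.
Proof.
move=> mg mh gh hoo; rewrite fineK// ge0_fin_numE.
  apply: le_lt_trans hoo; apply: ge0_le_integral => //.
  - by move=> y _; rewrite lee_fin; have /andP[] := gh y.
  - exact/measurable_EFinP.
  - exact/measurable_EFinP.
  - by move=> y _; rewrite lee_fin; have /andP[] := gh y.
by apply: integral_ge0 => y _; rewrite lee_fin; have /andP[] := gh y.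
Qed.

Lemma integral_weight_two_val (w : R -> R) a u v Q : measurable_fun [set: R] w ->
  (forall y, 0 <= w y) -> 0 <= u -> 0 <= v ->
  (\int[F0]_y (w y)%:E = 1)%E ->
  (\int[F0]_y (w y * two_val a 1 0 y)%:E = Q%:E)%E ->
  (\int[F0]_y (w y * two_val a u v y)%:E = (u * Q + v * (1 - Q))%:E)%E.
Proof.
move=> mw w0 u0 v0 w1 wQ.
have m2 b c : measurable_fun [set: R] (fun y => w y * two_val a b c y).
  by apply: measurable_funM => //; exact: measurable_two_val.
have g2 b c y : 0 <= b -> 0 <= c -> 0 <= w y * two_val a b c y.
  by move=> b0 c0; rewrite mulr_ge0// two_val_ge0.
have ED b c : 0 <= b -> 0 <= c ->
  (\int[F0]_y (w y * two_val a b c y)%:E = b%:E * \int[F0]_y (w y * two_val a 1 0 y)%:E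
    + c%:E * \int[F0]_y (w y * two_val a 0 1 y)%:E)%E.
  move=> b0 c0; rewrite -!ge0_integralZl_EFin//; last 4 first.
  - by move=> y _; rewrite lee_fin g2.
  - exact/measurable_EFinP.
  - by move=> y _; rewrite lee_fin g2.
  - exact/measurable_EFinP.
  rewrite -ge0_integralD//; last 4 first.
  - by move=> y _; rewrite -EFinM lee_fin mulr_ge0// g2.
  - by under eq_fun do rewrite -EFinM; apply/measurable_EFinP/measurable_funM.
  - by move=> y _; rewrite -EFinM lee_fin mulr_ge0// g2.
  - by under eq_fun do rewrite -EFinM; apply/measurable_EFinP/measurable_funM.
  apply: eq_integral => y _; rewrite -!EFinM -EFinD; congr EFin.
  by rewrite /two_val; case: ifP => _; ring.
(* The mass of the complement comes from additivity with both values equal to 1, not from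
   subtracting integrals. *)
have E01 : (\int[F0]_y (w y * two_val a 0 1 y)%:E = (1 - Q)%:E)%E.
  have := ED 1 1 ler01 ler01; rewrite wQ !mul1e.
  under eq_integral do rewrite /two_val if_same mulr1.
  rewrite w1; case: (\int[F0]_y (w y * two_val a 0 1 y)%:E)%E => [r||] //.
  by rewrite -EFinD => -[->]; congr EFin; ring.
by rewrite ED// wQ E01 -!EFinM -EFinD.
Qed.

Lemma measurable_density t : measurable_fun [set: R] (expfam_density F0 t).
Proof.
apply: (measurableT_comp (@measurable_expR R)).
by apply: measurable_funB => //; exact: measurable_funM.
Qed.

Lemma density_ge0 t y : 0 <= expfam_density F0 t y.
Proof. exact: expR_ge0. Qed.

Lemma densityE t y : 0 < mgf F0 t ->
  expfam_density F0 t y = (mgf F0 t)^-1 * expR (t * y).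
Proof. by move=> p; rewrite /expfam_density expRD expRN lnK ?posrE// mulrC. Qed.

Lemma measurable_expRM (t : R) : measurable_fun [set: R] (fun y : R => expR (t * y)).
Proof. by apply: (measurableT_comp (@measurable_expR R)); exact: measurable_funM. Qed.

Lemma mgfE t : mgf_finite F0 t -> (\int[F0]_x (expR (t * x))%:E = (mgf F0 t)%:E)%E.
Proof. by move=> /integrable_fin_num h; rewrite fineK// h. Qed.

Lemma mgf_ge0 t : 0 <= mgf F0 t.
Proof. by apply: fine_ge0; apply: integral_ge0 => y _; rewrite lee_fin expR_ge0. Qed.

Lemma integral_density t : 0 < mgf F0 t -> mgf_finite F0 t ->
  (\int[F0]_y (expfam_density F0 t y)%:E = 1)%E.
Proof.
move=> p ft; under eq_integral do rewrite densityE// EFinM.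
rewrite ge0_integralZl_EFin//; last 2 first.
- by apply/measurable_EFinP; exact: measurable_expRM.
- by rewrite invr_ge0 ltW.
by rewrite mgfE// -EFinM mulVf// gt_eqF.
Qed.


Lemma mgf_gt0 (a t : R) : (0 < F0 `]a, +oo[%classic)%E -> 0 < t ->
  mgf_finite F0 t -> 0 < mgf F0 t.
Proof.
move=> Fa t0 ft; rewrite -lte_fin -mgfE//.
apply: (@lt_le_trans _ _ ((expR (t * a))%:E * F0 `]a, +oo[%classic)%E).
  by rewrite mule_gt0// lte_fin expR_gt0.
rewrite -integral_two_val10 -ge0_integralZl_EFin ?expR_ge0//; last 2 first.
- by move=> y _; rewrite lee_fin two_val_ge0.
- by apply/measurable_EFinP; exact: measurable_two_val.
apply: ge0_le_integral => //.
- by move=> y _; rewrite -EFinM lee_fin mulr_ge0 ?expR_ge0// two_val_ge0.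
- under eq_fun do rewrite -EFinM; apply/measurable_EFinP; apply: measurable_funM => //.
  exact: measurable_two_val.
- by apply/measurable_EFinP; exact: measurable_expRM.
move=> y _; rewrite -EFinM lee_fin /two_val; case: ifP => ay.
  by rewrite mulr1 ler_expR ler_pM2l// ltW.
by rewrite mulr0 expR_ge0.
Qed.

(** Split the generating function at [a] into [A] (above) and [B] (below), so that
    [Q = A / (A + B)]. Above [a], [exp(t (y - a)) >= 1 + t e] once [y > a + e], so
    [A >= exp(t a) (q + t b)]; below, [B <= exp(t a) (1 - q)]. Hence [Q >= (q + t b) / (1 + t b)].
    The bound holds for every [t > 0] and saturates for large [t]. *)
Lemma tail_gain (a e t : R) (q := fine (F0 `]a, +oo[%classic))
    (b := e * fine (F0 `](a + e)%R, +oo[%classic)) :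
  0 < e -> 0 < t -> mgf_finite F0 t -> 0 < mgf F0 t -> q <= 1 ->
  exists2 Q, (\int[F0]_y (expfam_density F0 t y * two_val a 1 0 y)%:E = Q%:E)%E
    & (1 - q) * (t * b / (1 + t * b)) <= Q - q.
Proof.
move=> e0 t0 ft p q1; have e0' := ltW e0; have t0' := ltW t0; have p' := ltW p.
have Ff (A : set R) : measurable A -> (F0 A = (fine (F0 A))%:E)%E.
  move=> mA; rewrite fineK// ge0_fin_numE ?measure_ge0//.
  by apply: le_lt_trans (probability_le1 _ mA) _; rewrite ltry.
have qE : (\int[F0]_y (two_val a 1 0 y)%:E = q%:E)%E by rewrite integral_two_val10 -Ff.
have bE : (e%:E * \int[F0]_y (two_val (a + e) 1 0 y)%:E = b%:E)%E.
  by rewrite integral_two_val10 Ff.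
have b0 : 0 <= b by apply: mulr_ge0 => //; exact: fine_ge0.
have mE u v : measurable_fun [set: R] (fun y => expR (t * y) * two_val a u v y).
  by apply: measurable_funM; [exact: measurable_expRM|exact: measurable_two_val].
have mgfoo : (\int[F0]_y (expR (t * y))%:E < +oo)%E by rewrite mgfE ?ltry.
pose A := fine (\int[F0]_y (expR (t * y) * two_val a 1 0 y)%:E)%E.
pose B := fine (\int[F0]_y (expR (t * y) * two_val a 0 1 y)%:E)%E.
have AE : (\int[F0]_y (expR (t * y) * two_val a 1 0 y)%:E = A%:E)%E.
  apply: (integral_fin _ (fun y => expR (t * y))) => // [|y]; first exact: measurable_expRM.
  by rewrite /two_val; case: ifP => _; rewrite ?mulr1 ?mulr0 ?lexx ?expR_ge0.
have BE : (\int[F0]_y (expR (t * y) * two_val a 0 1 y)%:E = B%:E)%E.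
  apply: (integral_fin _ (fun y => expR (t * y))) => // [|y]; first exact: measurable_expRM.
  by rewrite /two_val; case: ifP => _; rewrite ?mulr1 ?mulr0 ?lexx ?expR_ge0.
have g2 u v y : 0 <= u -> 0 <= v -> 0 <= expR (t * y) * two_val a u v y.
  by move=> u0 v0; rewrite mulr_ge0 ?expR_ge0// two_val_ge0.
have ABE : A + B = mgf F0 t.
  apply: EFin_inj; rewrite EFinD -AE -BE -mgfE// -ge0_integralD//; last 4 first.
  - by move=> y _; rewrite lee_fin g2.
  - exact/measurable_EFinP.
  - by move=> y _; rewrite lee_fin g2.
  - exact/measurable_EFinP.
  apply: eq_integral => y _; rewrite -EFinD; congr EFin.
  by rewrite /two_val; case: ifP => _; ring.
pose E := expR (t * a); have E0 : 0 < E by exact: expR_gt0.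
have HA : E * (q + t * b) <= A.
  rewrite -lee_fin -AE EFinM EFinD EFinM -qE -bE muleA -EFinM.
  rewrite -ge0_integralZl_EFin ?mulr_ge0//; last 2 first.
  - by move=> y _; rewrite lee_fin two_val_ge0.
  - by apply/measurable_EFinP; exact: measurable_two_val.
  rewrite -ge0_integralD//; last 4 first.
  - by move=> y _; rewrite lee_fin two_val_ge0.
  - by apply/measurable_EFinP; exact: measurable_two_val.
  - by move=> y _; rewrite -EFinM lee_fin mulr_ge0 ?two_val_ge0// mulr_ge0//.
  - under eq_fun do rewrite -EFinM; apply/measurable_EFinP; apply: measurable_funM => //.
    exact: measurable_two_val.
  have f0 y : 0 <= two_val a 1 0 y + t * e * two_val (a + e) 1 0 y.
    by rewrite addr_ge0 ?two_val_ge0// mulr_ge0 ?two_val_ge0// mulr_ge0//.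
  have mf : measurable_fun [set: R] (fun y => two_val a 1 0 y + t * e * two_val (a + e) 1 0 y).
    apply: measurable_funD; first exact: measurable_two_val.
    by apply: measurable_funM => //; exact: measurable_two_val.
  under eq_integral do rewrite -EFinM -EFinD.
  rewrite -ge0_integralZl_EFin ?expR_ge0//; last 2 first.
  - by move=> y _; rewrite lee_fin f0.
  - exact/measurable_EFinP.
  apply: ge0_le_integral => //.
  - by move=> y _; rewrite -EFinM lee_fin mulr_ge0// expR_ge0.
  - by under eq_fun do rewrite -EFinM; apply/measurable_EFinP; apply: measurable_funM.
  - exact/measurable_EFinP.
  move=> y _; rewrite -EFinM lee_fin.
  have -> : expR (t * y) = E * expR (t * (y - a)) by rewrite /E -expRD; congr expR; ring.
  rewrite -mulrA; apply: ler_wpM2l; first exact: expR_ge0.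
  rewrite /two_val; have := expR_ge1Dx (t * (y - a)).
  case: ltrP => ay; last by rewrite ltNge (le_trans ay) ?lerDl//= !mulr0 addr0.
  have tya : 0 <= t * (y - a) by rewrite mulr_ge0// subr_ge0 ltW.
  case: ltrP => aey.
    by have : t * e <= t * (y - a) by [rewrite ler_pM2l// lerBrDl ltW|]; lra.
  by lra.
have HB : B <= E * (1 - q).
  have : (\int[F0]_y (1 * two_val a 0 1 y)%:E = (0 * q + 1 * (1 - q))%:E)%E.
    apply: integral_weight_two_val => //.
      by rewrite integral_cst// mul1e; exact: probability_setT.
    by under eq_integral do rewrite mul1r.
  rewrite mul0r add0r mul1r; under eq_integral do rewrite mul1r.
  move=> h; rewrite -lee_fin -BE EFinM -h.
  rewrite -ge0_integralZl_EFin ?expR_ge0//; last 2 first.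
  - by move=> y _; rewrite lee_fin two_val_ge0.
  - by apply/measurable_EFinP; exact: measurable_two_val.
  apply: ge0_le_integral => //.
  - by move=> y _; rewrite lee_fin g2.
  - exact/measurable_EFinP.
  - under eq_fun do rewrite -EFinM; apply/measurable_EFinP; apply: measurable_funM => //.
    exact: measurable_two_val.
  move=> y _; rewrite -EFinM lee_fin /two_val; case: ltrP => ay; rewrite ?mulr0// !mulr1.
  by rewrite ler_expR ler_pM2l.
exists ((mgf F0 t)^-1 * A).
  under eq_integral do rewrite densityE// -mulrA EFinM.
  rewrite ge0_integralZl_EFin ?invr_ge0//; last 2 first.
  - by move=> y _; rewrite lee_fin g2.
  - exact/measurable_EFinP.
  by rewrite AE.
rewrite -ABE in p *.
have q0 : 0 <= q by exact: fine_ge0.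
have s0 : 0 <= t * b by rewrite mulr_ge0.
set s := t * b in s0 HA *.
have key : (q + s) * B <= A * (1 - q).
  apply: (@le_trans _ _ ((q + s) * (E * (1 - q)))).
    by rewrite ler_wpM2l// addr_ge0.
  by rewrite mulrA [_ * E]mulrC ler_wpM2r// subr_ge0.
rewrite lerBrDr.
have -> : (1 - q) * (s / (1 + s)) + q = (q + s) / (1 + s) by field; lra.
rewrite [leRHS]mulrC ler_pdivrMr ?ltr_wpDr// mulrAC ler_pdivlMr//; nra.
Qed.

(** Pairs are (coefficient, exponent). Moving every negative term to the other side turns a
    Taylor-type estimate into one between nonnegative combinations of exponentials, which integrates
    without moments or derivatives of [mgf]. *)
Lemma le_expR_comb (l k : seq (R * R)) :
  (forall z, z \in l ++ k -> 0 <= z.1 /\ mgf_finite F0 z.2) ->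
  (forall y, \sum_(z <- l) z.1 * expR (z.2 * y) <= \sum_(z <- k) z.1 * expR (z.2 * y)) ->
  \sum_(z <- l) z.1 * mgf F0 z.2 <= \sum_(z <- k) z.1 * mgf F0 z.2.
Proof.
have mc (c u : R) : measurable_fun [set: R] (fun y => c * expR (u * y)).
  by apply: measurable_funM => //; exact: measurable_expRM.
have ms (h : seq (R * R)) : measurable_fun [set: R] (fun y => \sum_(z <- h) z.1 * expR (z.2 * y)).
  exact: measurable_sum.
have s0 (h : seq (R * R)) : {in h, forall z, 0 <= z.1 /\ mgf_finite F0 z.2} ->
    forall y, 0 <= \sum_(z <- h) z.1 * expR (z.2 * y).
  move=> hh y; rewrite big_seq sumr_ge0// => z /hh[z0 _].
  by rewrite mulr_ge0// expR_ge0.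
have E (h : seq (R * R)) : {in h, forall z, 0 <= z.1 /\ mgf_finite F0 z.2} ->
    (\int[F0]_y (\sum_(z <- h) z.1 * expR (z.2 * y))%:E =
     (\sum_(z <- h) z.1 * mgf F0 z.2)%:E)%E.
  elim: h => [|z h IH] hh.
    by under eq_integral do rewrite big_nil; rewrite big_nil integral0.
  have [z0 fz] := hh z (mem_head _ _).
  have {}hh : {in h, forall z, 0 <= z.1 /\ mgf_finite F0 z.2}.
    by move=> u uh; apply: hh; rewrite inE uh orbT.
  under eq_integral do rewrite big_cons EFinD.
  rewrite ge0_integralD//; last 4 first.
  - by move=> y _; rewrite lee_fin mulr_ge0// expR_ge0.
  - exact/measurable_EFinP.
  - by move=> y _; rewrite lee_fin s0.
  - exact/measurable_EFinP.
  rewrite IH// big_cons EFinD EFinM -mgfE// -ge0_integralZl_EFin//.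
  by apply/measurable_EFinP; exact: measurable_expRM.
move=> Hz le_lk.
have Hl : {in l, forall z, 0 <= z.1 /\ mgf_finite F0 z.2}.
  by move=> z zl; apply: Hz; rewrite mem_cat zl.
have Hk : {in k, forall z, 0 <= z.1 /\ mgf_finite F0 z.2}.
  by move=> z zk; apply: Hz; rewrite mem_cat zk orbT.
rewrite -lee_fin -!E//; apply: ge0_le_integral => //.
- by move=> y _; rewrite lee_fin s0.
- exact/measurable_EFinP.
- exact/measurable_EFinP.
- by move=> y _; rewrite lee_fin.
Qed.

(** Both sides rest on [u <= exp(s u) / s]. For [y >= 0], [exp(t y) - 1 <= t y exp(t y) <= t exp(2 s
    y) / s]; for [y <= 0], [1 - exp(t y) <= - t y <= t exp(- s y) / s]. Squaring produces the two
    exponentials and keeps the factor [t^2]. *)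
Lemma sqr_expR_sub1_le (s t y : R) : 0 < t -> t <= s ->
  (expR (t * y) - 1) ^+ 2 <=
  t ^+ 2 * (expR (4 * s * y) + expR (- (2 * s) * y)) / s ^+ 2.
Proof.
move=> t0 ts; have s0 : 0 < s by exact: lt_le_trans ts.
have xs u : u <= expR (s * u) / s.
  rewrite ler_pdivlMr// mulrC; apply: le_trans (expR_ge1Dx _); lra.
have [y0|/ltW y0] := leP 0 y.
  have h1 : expR (t * y) - 1 <= t * y * expR (t * y).
    have := expR_ge1Dx (- (t * y)); rewrite expRN => h.
    have := ler_wpM2r (expR_ge0 (t * y)) h.
    by rewrite mulVf ?gt_eqF ?expR_gt0//; lra.
  have h2 : t * y * expR (t * y) <= t * (expR (s * y) / s) * expR (s * y).
    apply: ler_pM; rewrite ?expR_ge0 ?mulr_ge0 ?(ltW t0)//.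
      by rewrite ler_wpM2l ?(ltW t0).
    by rewrite ler_expR ler_wpM2r.
  have h0 : 0 <= expR (t * y) - 1.
    by rewrite subr_ge0 -[X in X <= _]expR0 ler_expR mulr_ge0// ltW.
  apply: (@le_trans _ _ ((t * (expR (s * y) / s) * expR (s * y)) ^+ 2)).
    by rewrite ler_sqr ?nnegrE//; lra.
  have -> : expR (4 * s * y) = expR (s * y) ^+ 4.
    by rewrite -expRM_natl; congr expR; ring.
  rewrite -subr_ge0.
  have -> : t ^+ 2 * (expR (s * y) ^+ 4 + expR (- (2 * s) * y)) / s ^+ 2 -
     (t * (expR (s * y) / s) * expR (s * y)) ^+ 2 = t ^+ 2 * expR (- (2 * s) * y) / s ^+ 2.
    by field; rewrite gt_eqF.
  by rewrite divr_ge0 ?sqr_ge0// mulr_ge0 ?sqr_ge0 ?expR_ge0.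
have h1 : 1 - expR (t * y) <= t * (expR (s * - y) / s).
  apply: (@le_trans _ _ (t * - y)); last by rewrite ler_wpM2l ?(ltW t0).
  by have := expR_ge1Dx (t * y); lra.
have h0 : 0 <= 1 - expR (t * y).
  by rewrite subr_ge0 -[X in _ <= X]expR0 ler_expR mulr_ge0_le0// ltW.
rewrite -sqrrN opprB.
apply: (@le_trans _ _ ((t * (expR (s * - y) / s)) ^+ 2)).
  by rewrite ler_sqr ?nnegrE//; lra.
have -> : expR (- (2 * s) * y) = expR (s * - y) ^+ 2.
  by rewrite -expRM_natl; congr expR; ring.
rewrite -subr_ge0.
have -> : t ^+ 2 * (expR (4 * s * y) + expR (s * - y) ^+ 2) / s ^+ 2 -
   (t * (expR (s * - y) / s)) ^+ 2 = t ^+ 2 * expR (4 * s * y) / s ^+ 2.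
  by field; rewrite gt_eqF.
by rewrite divr_ge0 ?sqr_ge0// mulr_ge0 ?sqr_ge0 ?expR_ge0.
Qed.

Lemma half_le_of_perturb (phi N s t : R) : 0 < s -> 0 <= N -> 0 < t ->
  t * (2 * (N + 1)) < s -> 1 <= phi + t / s * N -> 1 / 2 <= phi.
Proof.
move=> s0 N0 t0 tN; have : t / s * N <= 1 / 2.
  by rewrite mulrAC ler_pdivrMr//; nra.
by lra.
Qed.

Lemma second_moment_ratio_le (phi phi2 K t : R) : 0 <= K -> 1 / 2 <= phi ->
  phi2 + 1 <= 2 * phi + t ^+ 2 * K -> phi ^- 2 * phi2 <= 1 + 4 * K * t ^+ 2.
Proof.
move=> K0 hphi H; have phi0 : 0 < phi by lra.
rewrite mulrC ler_pdivrMr ?exprn_gt0//.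
have h : 1 <= 4 * phi ^+ 2 by nra.
have : t ^+ 2 * K * 1 <= t ^+ 2 * K * (4 * phi ^+ 2).
  by apply: ler_wpM2l => //; rewrite mulr_ge0// sqr_ge0.
by have := sqr_ge0 (phi - 1); rewrite !expr2; lra.
Qed.

(** The second moment is [mgf (2 t) / mgf t ^ 2], while [mgf (2 t) - 2 mgf t + 1], the mean of
    [(exp(t X) - 1)^2], is [O(t^2)]. Since [2 mgf t - 1 <= mgf t ^ 2], only a lower bound on [mgf t]
    is missing. *)
Lemma second_moment_density : mgf_finite_near0 F0 ->
  exists C r : R, [/\ 0 <= C, 0 < r & forall t, 0 < t < r ->
    [/\ 0 < mgf F0 t, mgf_finite F0 t & exists2 c,
      (\int[F0]_y (expfam_density F0 t y * expfam_density F0 t y)%:E = c%:E)%E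
      & c <= 1 + C * t ^+ 2]].
Proof.
move=> [e [e0 fe]].
(* With [t <= s], the exponents [4 * s], [- (2 * s)], [- s] and [2 * t] all stay within distance [e]
   of 0. *)
pose s := e / 8; have s0 : 0 < s by rewrite divr_gt0.
have f4 : mgf_finite F0 (4 * s) by apply: fe; rewrite ger0_norm /s; lra.
have f2 : mgf_finite F0 (- (2 * s)) by apply: fe; rewrite normrN ger0_norm /s; lra.
have f1 : mgf_finite F0 (- s) by apply: fe; rewrite normrN ger0_norm /s; lra.
pose K := (mgf F0 (4 * s) + mgf F0 (- (2 * s))) / s ^+ 2.
have K0 : 0 <= K by rewrite divr_ge0 ?sqr_ge0// addr_ge0// mgf_ge0.
pose N := mgf F0 (- s) + 1; have N1 : 1 <= N by rewrite lerDr mgf_ge0.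
exists (4 * K), (s / (2 * N)); split; [by rewrite mulr_ge0|by rewrite divr_gt0; lra|].
move=> t /andP[t0 tr].
have ts : t <= s.
  apply: ltW; apply: lt_le_trans tr _; rewrite ler_pdivrMr; nra.
have ft : mgf_finite F0 t by apply: fe; rewrite gtr0_norm//; rewrite /s in ts; lra.
have f2t : mgf_finite F0 (2 * t).
  by apply: fe; rewrite gtr0_norm ?mulr_gt0//; rewrite /s in ts; lra.

have f00 : mgf_finite F0 0 by apply: fe; rewrite normr0.
have mgf0 : mgf F0 0 = 1.
  apply: EFin_inj; rewrite -mgfE//.
  under eq_integral do rewrite mul0r expR0.
  by rewrite integral_cst// mul1e; exact: probability_setT.
have H1 : mgf F0 (2 * t) + 1 <= 2 * mgf F0 t + t ^+ 2 * K.
  have := @le_expR_comb [:: (1, 2 * t); (1, 0)]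
    [:: (2, t); (t ^+ 2 / s ^+ 2, 4 * s); (t ^+ 2 / s ^+ 2, - (2 * s))].
  rewrite !big_cons !big_nil /= mgf0 !addr0 !mul1r.
  have -> : t ^+ 2 * K = t ^+ 2 / s ^+ 2 * mgf F0 (4 * s) + t ^+ 2 / s ^+ 2 * mgf F0 (- (2 * s)).
    by rewrite /K; field; rewrite gt_eqF.
  apply.
    have c0 : 0 <= t ^+ 2 / s ^+ 2 by rewrite divr_ge0 ?sqr_ge0.
    by move=> z; rewrite !inE => /or4P[|||/orP[]] /eqP -> /=; split.
  move=> y; rewrite !big_cons !big_nil /= mul0r expR0 !addr0 !mul1r.
  have := @sqr_expR_sub1_le s t y t0 ts.
  have -> : expR (2 * t * y) = expR (t * y) ^+ 2.
    by rewrite -expRM_natl; congr expR; ring.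
  have -> : t ^+ 2 * (expR (4 * s * y) + expR (- (2 * s) * y)) / s ^+ 2 =
    t ^+ 2 / s ^+ 2 * expR (4 * s * y) + t ^+ 2 / s ^+ 2 * expR (- (2 * s) * y).
    by ring.
  by lra.
(* In [exp(t y) + (t / s) exp(- s y)] the first-order terms in [y] cancel, so the sum is at least 1.
   The choice of [N] and of the radius [s / (2 * N)] makes the second mean at most 1/2. *)
have H2 : 1 <= mgf F0 t + t / s * mgf F0 (- s).
  have := @le_expR_comb [:: (1, 0)] [:: (1, t); (t / s, - s)].
  rewrite !big_cons !big_nil /= mgf0 !addr0 !mul1r; apply.
    have c0 : 0 <= t / s by rewrite divr_ge0 ?ltW.
    by move=> z; rewrite !inE => /or3P[] /eqP -> /=; split.
  move=> y; rewrite !big_cons !big_nil /= mul0r expR0 !addr0 !mul1r.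
  have h1 := expR_ge1Dx (t * y); have h2 := expR_ge1Dx (- s * y).
  have : t / s * (1 + - s * y) <= t / s * expR (- s * y).
    by rewrite ler_wpM2l// divr_ge0 ?ltW.
  have -> : t / s * (1 + - s * y) = t / s - t * y by field; rewrite gt_eqF.
  have : 0 <= t / s by rewrite divr_ge0 ?ltW.
  by lra.
have phi2 : 1 / 2 <= mgf F0 t.
  apply: (half_le_of_perturb _ _ _ _ s0 (mgf_ge0 (- s)) t0 _ H2).
  by rewrite -ltr_pdivlMr// mulr_gt0// (lt_le_trans ltr01).
have phi0 : 0 < mgf F0 t by exact: lt_le_trans phi2.
split => //; exists ((mgf F0 t) ^- 2 * mgf F0 (2 * t)).
  have sqE y : expfam_density F0 t y * expfam_density F0 t y =
      (mgf F0 t) ^- 2 * expR (2 * t * y).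
    have -> : expR (2 * t * y) = expR (t * y) ^+ 2.
      by rewrite -expRM_natl; congr expR; ring.
    by rewrite densityE//; field; rewrite gt_eqF.
  under eq_integral do rewrite sqE EFinM.
  rewrite ge0_integralZl_EFin//; last 2 first.
  - by apply/measurable_EFinP; exact: measurable_expRM.
  - by rewrite invr_ge0 sqr_ge0.
  by rewrite mgfE.
exact: second_moment_ratio_le.
Qed.

End OneDim.

(** * Bounds on the Bayes risk *)

Section PathVertices.
Context (n : nat) (p : {ffun 'I_n.+1 -> 'I_(2 * n.+1).+1}) (hp : p \in Paths n.+1).

Definition path_vtx (i : 'I_n.+1) : vtx n.+1 :=
  exist _ (i, p i) (Paths_in_lattice n p i hp).

(** A path meets each column exactly once, so the vertices on it are indexed by time. *)
Lemma big_on_path (V : Type) (idx : V) (op : Monoid.com_law idx) (P : pred (vtx n.+1))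
    (F : vtx n.+1 -> V) :
  \big[op/idx]_(v | on_path n.+1 p v && P v) F v =
  \big[op/idx]_(i | P (path_vtx i)) F (path_vtx i).
Proof.
rewrite (reindex path_vtx)/=.
  by apply: eq_bigl => i; rewrite /on_path/= eqxx.
exists (fun v => (val v).1) => [i _|v] //=.
rewrite inE => /andP[/eqP pv _]; apply: val_inj => /=.
by rewrite [LHS]/= pv -surjective_pairing.
Qed.

End PathVertices.

(** * Lower bound on the risk by the second moment of the likelihood ratio *)

Section RiskBounds.
Context (R : realType) (F0 : probability R R) (n : nat).
Let m := n.+1.
Notation S := (sampleM R m).
Notation I w f := (iint F0 m (enum {: vtx m}) w f (fun=> 0)).

Lemma iint_prod_enum (w h : vtx m -> R -> R) (c : vtx m -> R) :
  weight R m w -> weight R m h ->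
  (forall v, \int[F0]_y (w v y * h v y)%:E = (c v)%:E)%E ->
  I w (fun x => (\prod_v h v (x v))%:E) = (\prod_v c v)%:E.
Proof.
move=> ww wh wc; rewrite (iint_prod _ _ _ _ _ _ c)// ?enum_uniq//; congr EFin.
rewrite [X in _ * X]big_pred0 ?mulr1; last by move=> v; rewrite mem_enum.
by apply: eq_bigl => v; rewrite mem_enum.
Qed.

Lemma w_alt_weight t p : weight R m (w_alt F0 m t p).
Proof.
move=> v; rewrite /w_alt; case: (on_path m p v); last first.
  by split=> [|y]; [exact: measurable_cst|exact: ler01].
by split; [exact: measurable_density|move=> y; exact: density_ge0].
Qed.

Lemma integral1 : (\int[F0]_y (1 : R)%:E = 1)%E.
Proof. by rewrite integral_cst// mul1e; exact: probability_setT. Qed.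

Lemma indic_mfun_ge0 (A : set S) : measurable A -> mfun_ge0 R m (fun x => (\1_A x)%:E).
Proof.
by move=> mA; split => [|x]; [exact/measurable_EFinP/measurable_indic|rewrite lee_fin].
Qed.

Section Alternative.
Context (t : R).
Hypotheses (phi0 : 0 < mgf F0 t) (ft : mgf_finite F0 t).

Lemma integral_w_alt p v : (\int[F0]_y (w_alt F0 m t p v y)%:E = 1)%E.
Proof.
rewrite /w_alt; case: (on_path m p v); last exact: integral1.
exact: integral_density.
Qed.

Lemma prodP_w_alt_le1 p (A : set S) : measurable A -> (prodP F0 m (w_alt F0 m t p) A <= 1)%E.
Proof.
move=> mA; rewrite /prodP.
have w1 := w_alt_weight t p.
apply: (@le_trans _ _ (I (w_alt F0 m t p) (fun x => (\prod_(v : vtx m) 1)%:E))).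
  apply: le_iint => //; first exact: indic_mfun_ge0.
    by rewrite big1//; exact: mfun_ge0_cst.
  by move=> x; rewrite big1// lee_fin indicE; case: (x \in A).
rewrite (iint_prod_enum _ (fun _ _ => 1) (fun=> 1))//; first by rewrite big1.
by move=> v; under eq_integral do rewrite mulr1; exact: integral_w_alt.
Qed.

Lemma prodP_w_altT p : prodP F0 m (w_alt F0 m t p) setT = 1%E.
Proof.
rewrite /prodP.
transitivity (I (w_alt F0 m t p) (fun x => (\prod_(v : vtx m) 1)%:E)).
  by apply: eq_iint => x; rewrite indicT big1.
rewrite (iint_prod_enum _ (fun _ _ => 1) (fun=> 1))//; first by rewrite big1.
  exact: w_alt_weight.
by move=> v; under eq_integral do rewrite mulr1; exact: integral_w_alt.
Qed.

Lemma sum_Paths_avg (c : R) :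
  (\sum_(p in Paths m) ((#|Paths m|%:R)^-1)%:E * c%:E = c%:E)%E.
Proof.
under eq_bigr do rewrite -EFinM.
rewrite sumEFin sumr_const -[_ *+ _]mulr_natl mulrA divff ?mul1r//.
by rewrite card_Paths pnatr_eq0 expn_eq0.
Qed.

Lemma bayes_risk_le1 : (bayes_risk F0 t m <= 1)%E.
Proof.
apply: ereal_inf_lbound; exists (fun=> false); split.
  rewrite /measurable_test (_ : _ @^-1` _ = set0); first exact: (@measurable0 _ S).
  by apply/seteqP; split => x.
rewrite (_ : (fun=> false) @^-1` [set true] = set0); last by apply/seteqP; split.
rewrite (_ : (fun=> false) @^-1` [set false] = setT); last by apply/seteqP; split.
under eq_bigr do rewrite prodP_w_altT.
rewrite sum_Paths_avg /prodP.
under eq_iint do rewrite indic0.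
by rewrite iint0 add0e.
Qed.

(* Polynomial substitute for [min(1, L) >= 1 - |1 - L|], which keeps every term
   nonnegative so that only positivity of the integral is used. *)
Lemma sqr_lower_bound (A : bool) (L eta : R) : 0 < eta -> 0 <= L ->
  1 + L / eta <= (if A then 1 else L) + (eta / 2 + (2 * eta)^-1 * (L ^+ 2 + 1)).
Proof.
move=> e0 L0; set u := eta^-1.
have u0 : 0 < u by rewrite invr_gt0.
have -> : eta = u^-1 by rewrite /u invrK.
have -> : (2 * u^-1)^-1 = u / 2 by field; rewrite gt_eqF.
have ui : u * u^-1 = 1 by rewrite divff// gt_eqF.
have ui0 : 0 < u^-1 by rewrite invr_gt0.
set w := u^-1 in ui ui0 *.
have : 0 <= w * (1 - u * (1 - L)) ^+ 2 by rewrite mulr_ge0 ?sqr_ge0// ltW.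
have -> : w * (1 - u * (1 - L)) ^+ 2 =
    w - 2 * (u * w) * (1 - L) + (u * w) * u * (1 - L) ^+ 2 by ring.
have : 0 <= w * (1 + u * (1 - L)) ^+ 2 by rewrite mulr_ge0 ?sqr_ge0// ltW.
have -> : w * (1 + u * (1 - L)) ^+ 2 =
    w + 2 * (u * w) * (1 - L) + (u * w) * u * (1 - L) ^+ 2 by ring.
rewrite [u * w]ui; have := mulr_ge0 (ltW u0) (sqr_ge0 (1 - L)).
by case: A; nra.
Qed.

(** The risk is the null mean of [1] on the rejection region and of [L] off it, hence at least
    [1 - E |1 - L|]. From [|1 - L| <= eta / 2 + (1 - L)^2 / (2 eta)] and [E L^2 <= 1 + eta^2] the
    loss is at most [eta]. *)
Lemma risk_lower (c x eta : R) : 0 <= x -> 0 < eta ->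
  (\int[F0]_y (expfam_density F0 t y * expfam_density F0 t y)%:E = c%:E)%E ->
  c <= 1 + x ->
  \sum_(p in Paths m) \sum_(q in Paths m)
    \prod_(i < m) (if p i == q i then 1 + x else 1) <=
  (#|Paths m|%:R) ^+ 2 * (1 + eta ^+ 2) ->
  ((1 - eta)%:E <= bayes_risk F0 t m)%E.
Proof.
move=> x0 e0 cE cx Hsum; apply: le_ereal_inf_tmp => _ [T [mT ->]].
set k : R := #|Paths m|%:R^-1.
have k0 : 0 <= k by rewrite invr_ge0.
have kN : k * #|Paths m|%:R = 1.
  by rewrite mulVf// card_Paths pnatr_eq0 expn_eq0.
set A : set S := T @^-1` [set true].
have mA : measurable A by exact: mT.
have -> : T @^-1` [set false] = ~` A.
  by apply/seteqP; split => z /=; rewrite /A/=; case: (T z).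
pose W p (z : S) := \prod_v w_alt F0 m t p v (z v).
have W0 p z : 0 <= W p z.
  by apply: prodr_ge0 => v _; exact: (w_alt_weight t p v).2.
have mW p : mfun_ge0 R m (fun z => (W p z)%:E).
  by apply: mfun_ge0_prod; exact: w_alt_weight.
pose L z := \sum_(p <- enum (Paths m)) k * W p z.
have L0 z : 0 <= L z by rewrite sumr_ge0// => p _; rewrite mulr_ge0.
have mkW p : mfun_ge0 R m (fun z => k%:E * (W p z)%:E)%E.
  by apply: mfun_ge0M => //; exact: mfun_ge0_cst.
have LE z : (L z)%:E = (\sum_(p <- enum (Paths m)) k%:E * (W p z)%:E)%E.
  by rewrite /L -sumEFin.
have mL : mfun_ge0 R m (fun z => (L z)%:E).
  by rewrite (funext LE); exact: mfun_ge0_sum.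
have w1 := weight1 R m.
have IW p : I (w_null m) (fun z => (W p z)%:E) = 1%E.
  rewrite (iint_prod_enum _ _ (fun=> 1))//; first by rewrite big1.
    exact: w_alt_weight.
  by move=> v; under eq_integral do rewrite mul1r; exact: integral_w_alt.
have IL : I (w_null m) (fun z => (L z)%:E) = 1%E.
  under eq_iint do rewrite LE.
  rewrite iint_sum//.
  under eq_bigr do rewrite iintZl// IW.
  by rewrite big_enum/= sum_Paths_avg.
(* A common vertex contributes [c]; a vertex on one path only integrates a density to 1. What
   remains is one factor for each time at which the paths agree. *)
have IWW p q : p \in Paths m -> q \in Paths m ->
  (I (w_null m) (fun z => (W p z * W q z)%:E) <=
   (\prod_(i < m) (if p i == q i then 1 + x else 1))%:E)%E.
  move=> pP qP.
  have c0 : 0 <= c.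
    rewrite -lee_fin -cE; apply: integral_ge0 => y _.
    by rewrite lee_fin mulr_ge0 ?density_ge0.
  under eq_iint do rewrite /W -big_split/=.
  rewrite (iint_prod_enum _ (fun v y => w_alt F0 m t p v y * w_alt F0 m t q v y)
    (fun v => if on_path m p v && on_path m q v then c else 1))//; last 2 first.
  - move=> v; have [m1 p1] := w_alt_weight t p v; have [m2 p2] := w_alt_weight t q v.
    by split; [exact: measurable_funM|move=> y; exact: mulr_ge0].
  - move=> v; under eq_integral do rewrite mul1r; rewrite /w_alt.
    case: (on_path m p v); case: (on_path m q v) => //=.
    + by under eq_integral do rewrite mulr1; exact: integral_density.
    + by under eq_integral do rewrite mul1r; exact: integral_density.
    + by under eq_integral do rewrite mulr1; exact: integral1.
  rewrite lee_fin -!big_mkcond/= (big_on_path n p pP).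
  rewrite [leLHS](eq_bigl (fun i => p i == q i)); last first.
    by move=> i; rewrite /on_path/= eq_sym.
  by apply: ler_prod => i _; rewrite c0 cx.
have IL2 : (I (w_null m) (fun z => (L z ^+ 2)%:E) <= (1 + eta ^+ 2)%:E)%E.
  have L2E z : (L z ^+ 2)%:E = (\sum_(p <- enum (Paths m)) \sum_(q <- enum (Paths m))
      (k ^+ 2)%:E * (W p z * W q z)%:E)%E.
    rewrite expr2 /L mulr_suml -sumEFin; apply: eq_bigr => p _.
    rewrite mulr_sumr -sumEFin; apply: eq_bigr => q _.
    by rewrite -EFinM; congr EFin; ring.
  have k20 : 0 <= k ^+ 2 by exact: sqr_ge0.
  have mWW p q : mfun_ge0 R m (fun z => (W p z * W q z)%:E).
    exact: (mfun_ge0M _ _ _ _ (mW p) (mW q)).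
  have mkWW p q : mfun_ge0 R m (fun z => (k ^+ 2)%:E * (W p z * W q z)%:E)%E.
    by apply: mfun_ge0M => //; exact: mfun_ge0_cst.
  under eq_iint do rewrite L2E.
  rewrite iint_sum//; last by move=> p; exact: mfun_ge0_sum.
  under eq_bigr do rewrite iint_sum//.
  under eq_bigr do (under eq_bigr do rewrite iintZl//).
  apply: (@le_trans _ _ (\sum_(p <- enum (Paths m)) \sum_(q <- enum (Paths m))
      (k ^+ 2)%:E * (\prod_(i < m) (if p i == q i then 1 + x else 1))%:E)%E).
    rewrite !big_enum/=; apply: lee_sum => p pP.
    rewrite !big_enum/=; apply: lee_sum => q qP.
    by rewrite lee_wpmul2l// IWW.
  under eq_bigr do (under eq_bigr do rewrite -EFinM; rewrite sumEFin -mulr_sumr).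
  rewrite sumEFin -mulr_sumr lee_fin big_enum/=.
  under eq_bigr do rewrite big_enum/=.
  apply: le_trans (ler_wpM2l k20 Hsum) _.
  by rewrite mulrA -exprMn kN expr1n mul1r.
have e0' := ltW e0.
(* Integrand of the risk under the null, after the alternative weights have been moved inside by
   [iint_density]. *)
pose g z := ((\1_A z)%:E + \sum_(p <- enum (Paths m)) k%:E * ((W p z)%:E * (\1_(~` A) z)%:E))%E.
have mB : mfun_ge0 R m (fun z => (\1_(~` A) z)%:E) by apply: indic_mfun_ge0; exact: measurableC.
have mWB p : mfun_ge0 R m (fun z => (W p z)%:E * (\1_(~` A) z)%:E)%E by exact: mfun_ge0M.
have mkWB p : mfun_ge0 R m (fun z => k%:E * ((W p z)%:E * (\1_(~` A) z)%:E))%E.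
  by apply: mfun_ge0M => //; exact: mfun_ge0_cst.
have mg : mfun_ge0 R m g.
  by apply: mfun_ge0D; [exact: indic_mfun_ge0|exact: mfun_ge0_sum].
have -> : (prodP F0 m (w_null m) A + \sum_(p in Paths m) k%:E *
    prodP F0 m (w_alt F0 m t p) (~` A))%E = I (w_null m) g.
  rewrite /g iintD//; [|exact: indic_mfun_ge0|exact: mfun_ge0_sum].
  congr (_ + _)%E; rewrite iint_sum// big_enum/=; apply: eq_bigr => p _.
  rewrite iintZl//; congr (_ * _)%E; rewrite /prodP iint_density ?enum_uniq//; last first.
    exact: w_alt_weight.
  by apply: eq_iint => z; rewrite big_enum.
pose h z := (eta / 2 + (2 * eta)^-1 * (L z ^+ 2 + 1)).
have hE z : (h z)%:E = ((eta / 2 + (2 * eta)^-1)%:E + (2 * eta)^-1%:E * (L z ^+ 2)%:E)%E.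
  by rewrite -EFinM -EFinD /h; congr EFin; ring.
have i2 : 0 <= (2 * eta)^-1 by rewrite invr_ge0 mulr_ge0.
have mL2 : mfun_ge0 R m (fun z => (L z ^+ 2)%:E).
  exact: (mfun_ge0M _ _ _ _ mL mL).
have c0 : 0 <= eta / 2 + (2 * eta)^-1 by rewrite addr_ge0// divr_ge0.
have mh2 : mfun_ge0 R m (fun z => (2 * eta)^-1%:E * (L z ^+ 2)%:E)%E.
  by apply: mfun_ge0M => //; exact: mfun_ge0_cst.
have mh : mfun_ge0 R m (fun z => (h z)%:E).
  by rewrite (funext hE); apply: mfun_ge0D => //; exact: mfun_ge0_cst.
have Icst (b : R) : 0 <= b -> I (w_null m) (fun=> b%:E) = b%:E.
  move=> b0; transitivity (I (w_null m) (fun z : S => b%:E * (\prod_(v : vtx m) 1)%:E)%E).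
    by apply: eq_iint => z; rewrite big1// mule1.
  rewrite iintZl//; last by rewrite big1//; exact: mfun_ge0_cst.
  rewrite (iint_prod_enum _ (fun _ _ => 1) (fun=> 1))//; first by rewrite big1 ?mule1.
  by move=> v; under eq_integral do rewrite mulr1; exact: integral1.
have Ih : (I (w_null m) (fun z => (h z)%:E) <= (eta + eta^-1)%:E)%E.
  under eq_iint do rewrite hE.
  rewrite iintD//.
  rewrite iintZl// Icst//.
  apply: le_trans (leeD2l _ (lee_wpmul2l _ IL2)) _; first by rewrite lee_fin.
  rewrite -EFinM -EFinD lee_fin le_eqVlt; apply/orP; left; apply/eqP.
  by field; rewrite gt_eqF.
have ei0 : 0 <= eta^-1 by rewrite invr_ge0.
have mLe : mfun_ge0 R m (fun z => eta^-1%:E * (L z)%:E)%E.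
  by apply: mfun_ge0M => //; exact: mfun_ge0_cst.
have Ilow : ((1 + eta^-1)%:E <= I (w_null m) g + I (w_null m) (fun z => (h z)%:E))%E.
  rewrite -iintD//.
  have -> : (1 + eta^-1)%:E = I (w_null m) (fun z => 1%:E + eta^-1%:E * (L z)%:E)%E.
    by rewrite iintD// ?iintZl// ?Icst// ?IL ?mule1//; exact: mfun_ge0_cst.
  apply: le_iint => //; [|exact: mfun_ge0D|].
    by apply: mfun_ge0D => //; exact: mfun_ge0_cst.
  move=> z; rewrite -EFinM -EFinD.
  have -> : g z = (if z \in A then 1 else L z)%:E.
    rewrite /g !indicE in_setC; case: (z \in A) => /=.
      by rewrite big1 ?adde0// => p _; rewrite !mule0.
    by rewrite add0e LE; apply: eq_bigr => p _; rewrite mule1.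
  by rewrite -EFinD lee_fin [_^-1 * _]mulrC; exact: sqr_lower_bound.
have := le_trans Ilow (leeD2l _ Ih).
rewrite -leeBlDr// -EFinB; congr (_ <= _)%E; congr EFin; ring.
Qed.

End Alternative.
End RiskBounds.

(** * Upper bound on the risk by a weighted count of exceedances in the band *)

Definition band (m L : nat) (v : vtx m) : bool := (`|jval m (val v).2| <= L%:Z)%R.

Lemma card_band m L : (0 < L)%N -> (#|band m L| <= 3 * (m * L))%N.
Proof.
move=> L0; pose f (v : vtx m) : 'I_m * 'I_(2 * L).+1 :=
  ((val v).1, inord (absz (jval m (val v).2 + L%:Z))).
have finj : {in band m L &, injective f}.
  move=> u v; rewrite !unfold_in /band => hu hv [e1 /(congr1 val)/= e2].
  apply: val_inj; rewrite [LHS]surjective_pairing [RHS]surjective_pairing e1.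
  congr (_, _); apply: (@jval_inj m); move: hu hv e2 => /=.
  by move: (jval _ _) (jval _ _) => x y hx hy; rewrite !inordK; lia.
rewrite -(card_in_imset finj).
apply: leq_trans (max_card _) _; rewrite card_prod !card_ord; nia.
Qed.

Section RiskUpper.
Context (R : realType) (F0 : probability R R) (n : nat).
Let m := n.+1.
Notation S := (sampleM R m).
Notation I w f := (iint F0 m (enum {: vtx m}) w f (fun=> 0)).

Lemma inv_sub_le (u : R) : 0 <= u <= 1 / 2 -> (1 - u)^-1 <= 1 + u + 2 * u ^+ 2.
Proof.
move=> /andP[u0 u1]; rewrite -[leLHS]mul1r ler_pdivrMr; last by lra.
have : 0 <= u ^+ 2 * (1 - 2 * u) by rewrite mulr_ge0 ?sqr_ge0//; lra.
by rewrite !expr2; lra.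
Qed.

Lemma inv_add_le (u : R) : 0 <= u -> (1 + u)^-1 <= 1 - u + 2 * u ^+ 2.
Proof.
move=> u0; rewrite -[leLHS]mul1r ler_pdivrMr; last by lra.
have : 0 <= u ^+ 2 * (1 + 2 * u) by rewrite mulr_ge0 ?sqr_ge0//; lra.
by rewrite !expr2; lra.
Qed.

(** Mean of one factor of [1 / Z] at a vertex with exceedance probability [Q]. To first order the
    inverses are [1 - lam (1 - q)] and [1 + lam q], with mean [1 - lam (Q - q)]; the remainders cost
    at most [2 lam^2]. Off the path it is used with [Q = q]. *)
Lemma two_val_inv_le (q Q lam : R) : 0 <= q <= 1 -> 0 <= Q <= 1 -> 0 <= lam <= 1 / 2 ->
  (1 + lam * (1 - q))^-1 * Q + (1 - lam * q)^-1 * (1 - Q) <=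
  expR (2 * lam ^+ 2 - lam * (Q - q)).
Proof.
move=> /andP[q0 q1] /andP[Q0 Q1] /andP[l0 l1].
apply: le_trans (expR_ge1Dx _).
have lq : 0 <= lam * q by exact: mulr_ge0.
have lq' : 0 <= lam * (1 - q) by rewrite mulr_ge0// subr_ge0.
have h1 : (1 - lam * q)^-1 <= 1 + lam * q + 2 * (lam * q) ^+ 2.
  by apply: inv_sub_le; rewrite lq/=; nra.
have h2 := inv_add_le _ lq'.
have Q1' : 0 <= 1 - Q by rewrite subr_ge0.
have := ler_wpM2r Q0 h2; have := ler_wpM2r Q1' h1.
have b1 : 2 * (lam * q) ^+ 2 * (1 - Q) <= 2 * lam ^+ 2 * (1 - Q).
  by apply: ler_wpM2r => //; rewrite exprMn ler_pM2l// ler_piMr ?sqr_ge0// expr_le1.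
have b2 : 2 * (lam * (1 - q)) ^+ 2 * Q <= 2 * lam ^+ 2 * Q.
  apply: ler_wpM2r => //; rewrite exprMn ler_pM2l// ler_piMr ?sqr_ge0//.
  by rewrite expr_le1// ?subr_ge0//; lra.
lra.
Qed.

(** The three terms are Markov for [Z] under the null, Markov for [1 / Z] on paths with at least
    half their vertices in the band, and the fraction of the other paths. The 6 is [2 lam^2] per
    vertex times the bound [3 m L] on the size of the band. *)
Lemma risk_upper (t a q Q del lam tau : R) (L : nat) :
  0 < mgf F0 t -> mgf_finite F0 t ->
  (\int[F0]_y (two_val R a 1 0 y)%:E = q%:E)%E ->
  (\int[F0]_y (expfam_density F0 t y * two_val R a 1 0 y)%:E = Q%:E)%E ->
  0 <= q <= 1 -> 0 <= Q <= 1 -> 0 <= del <= Q - q -> 0 <= lam <= 1 / 2 ->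
  (0 < L)%N -> 0 < tau ->
  (bayes_risk F0 t m <= (tau^-1 +
    tau * expR (6 * lam ^+ 2 * m%:R * L%:R - lam * del * m%:R / 2) +
    2 * m%:R / L%:R ^+ 2)%:E)%E.
Proof.
move=> phi0 ft qE QE q01 Q01 /andP[d0 dQ] l01 L0 tau0.
have [q0 q1] := andP q01; have [Q0 Q1] := andP Q01; have [l0 l1] := andP l01.
have tau0' := ltW tau0.
set k : R := #|Paths m|%:R^-1.
have k0 : 0 <= k by rewrite invr_ge0.
(* First-order version of exponential weights, [1 + lam (indicator - q)], whose null mean is exactly
   1: the null error then carries no exponential cost. *)
set al := 1 - lam * q; set be := 1 + lam * (1 - q).
have al0 : 0 < al by rewrite /al; nra.
have be0 : 0 < be by rewrite /be; nra.
pose hz (v : vtx m) (y : R) := if band m L v then two_val R a be al y else 1.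
have wz : weight R m hz.
  move=> v; rewrite /hz; case: (band m L v).
    split; first exact: measurable_two_val.
    by move=> y; rewrite two_val_ge0// ltW.
  by split => [|y]; [exact: measurable_cst|exact: ler01].
pose hi (v : vtx m) (y : R) := if band m L v then two_val R a be^-1 al^-1 y else 1.
have wi : weight R m hi.
  move=> v; rewrite /hi; case: (band m L v).
    split; first exact: measurable_two_val.
    by move=> y; rewrite two_val_ge0// invr_ge0 ltW.
  by split => [|y]; [exact: measurable_cst|exact: ler01].
(* Reject when [Z >= tau], where [Z] has null mean 1; under the alternative
   [1 / Z] has exponentially small mean. *)
pose Z (x : S) := \prod_v hz v (x v).
have Z0 x : 0 < Z x.
  by apply: prodr_gt0 => v _; rewrite /hz/two_val; do 2 case: ifP => //.
have ZV x : (Z x)^-1 = \prod_v hi v (x v).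
  rewrite /Z -prodfV; apply: eq_bigr => v _.
  by rewrite /hz /hi /two_val; case: ifP => // _; [case: ifP|rewrite invr1].
have mZ : mfun_ge0 R m (fun x => (Z x)%:E) by exact: mfun_ge0_prod.
have mZV : mfun_ge0 R m (fun x => (Z x)^-1%:E).
  by rewrite (funext (fun x => congr1 EFin (ZV x))); exact: mfun_ge0_prod.
have w1 := weight1 R m.
have IZ : I (w_null m) (fun x => (Z x)%:E) = 1%E.
  rewrite (iint_prod_enum _ _ _ _ _ (fun=> 1))//; first by rewrite big1.
  move=> v; rewrite /hz; case: (band m L v).
    rewrite (integral_weight_two_val _ _ (fun=> 1) _ _ _ q)//.
    - by congr EFin; rewrite /al /be; ring.
    - exact: ltW.
    - exact: ltW.
    - exact: integral1.
    - by under eq_integral do rewrite mul1r.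
  by under eq_integral do rewrite mulr1; exact: integral1.
have IZV p : p \in Paths m ->
  (I (w_alt F0 m t p) (fun x => (Z x)^-1%:E) <=
   (expR (6 * lam ^+ 2 * m%:R * L%:R -
     lam * del * (\sum_(i < m) (`|jval m (p i)| <= L%:Z)%R%:R)))%:E)%E.
  move=> pP; under eq_iint do rewrite ZV.
  pose c (v : vtx m) := if band m L v then
    (if on_path m p v then be^-1 * Q + al^-1 * (1 - Q) else
      be^-1 * q + al^-1 * (1 - q)) else 1.
  rewrite (iint_prod_enum _ _ _ _ _ c)//; last 2 first.
  - exact: w_alt_weight.
  - move=> v; rewrite /c /hi /w_alt; case: (band m L v); case: (on_path m p v).
    + apply: integral_weight_two_val; rewrite ?invr_ge0 1?ltW//.
      * exact: measurable_density.
      * by move=> y; exact: density_ge0.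
      * exact: integral_density.
    + apply: integral_weight_two_val; rewrite ?invr_ge0 1?ltW//.
      * exact: integral1.
      * by under eq_integral do rewrite mul1r.
    + by under eq_integral do rewrite mulr1; exact: integral_density.
    + by under eq_integral do rewrite mulr1; exact: integral1.
  rewrite lee_fin.
  (* Each band vertex costs [2 lam^2], and each one on the path gains [lam * del]. *)
  apply: (@le_trans _ _ (\prod_v expR (2 * lam ^+ 2 * (band m L v)%:R -
      lam * del * (on_path m p v && band m L v)%:R))).
    apply: ler_prod => v _; rewrite /c; apply/andP; split.
      case: ifP => // _; case: ifP => _; rewrite addr_ge0// mulr_ge0 ?subr_ge0// invr_ge0 ltW//.
    case: (band m L v); last by rewrite andbF !mulr0 subr0 expR0.
    rewrite andbT mulr1; case: (on_path m p v); rewrite ?mulr1 ?mulr0 ?subr0.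
      apply: le_trans (two_val_inv_le _ _ _ q01 Q01 l01) _.
      by rewrite ler_expR lerD2l lerN2 ler_wpM2l.
    apply: le_trans (two_val_inv_le _ _ _ q01 q01 l01) _.
    by rewrite subrr mulr0 subr0.
  rewrite -expR_sum ler_expR sumrB -!mulr_sumr.
  have -> : \sum_(v : vtx m) (on_path m p v && band m L v)%:R =
      \sum_(i < m) (`|jval m (p i)| <= L%:Z)%R%:R :> R.
    rewrite -[LHS]natr_sum -[RHS]natr_sum; congr (_%:R).
    rewrite -[LHS]big_mkcond -[RHS]big_mkcond/=.
    exact: (big_on_path n p pP).
  rewrite lerD2r.
  have -> : \sum_(v : vtx m) (band m L v)%:R = #|band m L|%:R :> R.
    rewrite -natr_sum; congr (_%:R); rewrite -sum1_card [RHS]big_mkcond.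
    apply: eq_bigr => v _; have -> : (v \in band m L) = band m L v by [].
    by case: (band m L v).
  have : #|band m L|%:R <= (3 * (m * L))%:R :> R by rewrite ler_nat card_band.
  rewrite !natrM => h.
  have -> : 6 * lam ^+ 2 * m%:R * L%:R = 2 * lam ^+ 2 * (3 * (m%:R * L%:R)) by ring.
  by rewrite ler_wpM2l// mulr_ge0// sqr_ge0.
pose T (x : S) := tau <= Z x.
pose A : set S := T @^-1` [set true].
have mT : measurable_fun [set: S] T.
  by apply: measurable_fun_ler => //; apply/measurable_EFinP; exact: mZ.1.
have mA : measurable A by rewrite -[A]setTI; exact: mT.
have mB : measurable (~` A) by exact: measurableC.
have AE x : (x \in A) = T x.
  by apply/idP/idP; rewrite inE /A /=.
have mtZ : mfun_ge0 R m (fun x => tau^-1%:E * (Z x)%:E)%E.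
  by apply: mfun_ge0M => //; apply: mfun_ge0_cst; rewrite invr_ge0.
have mtZV : mfun_ge0 R m (fun x => tau%:E * (Z x)^-1%:E)%E.
  by apply: mfun_ge0M => //; exact: mfun_ge0_cst.
have PA : (prodP F0 m (w_null m) A <= tau^-1%:E)%E.
  rewrite -[leRHS]mule1 -IZ -iintZl ?invr_ge0//.
  apply: le_iint => //; first exact: indic_mfun_ge0.
  move=> x; rewrite -EFinM lee_fin indicE AE /T; case: (leP tau (Z x)) => [h|_].
    by rewrite mulrC ler_pdivlMr// mul1r.
  by rewrite mulr_ge0 ?invr_ge0// ltW.
set e := expR (6 * lam ^+ 2 * m%:R * L%:R - lam * del * m%:R / 2).
have m0 : 0 < m%:R :> R by [].
have L20 : 0 < L%:R ^+ 2 :> R by rewrite exprn_gt0// ltr0n.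
have PB p : p \in Paths m -> (prodP F0 m (w_alt F0 m t p) (~` A) <=
    (2 / (m%:R * L%:R ^+ 2) * (\sum_(i < m) (jval m (p i))%:~R ^+ 2) + tau * e)%:E)%E.
  move=> pP; pose N : R := \sum_(i < m) (`|jval m (p i)| <= L%:Z)%R%:R.
  pose J : R := \sum_(i < m) (jval m (p i))%:~R ^+ 2.
  (* Chebyshev by counting: each time spent outside the band adds at least [L^2] to [J]. *)
  have NJ : m%:R - N <= J / L%:R ^+ 2.
    rewrite /J mulr_suml /N -[m in m%:R]card_ord -sum1_card natr_sum -sumrB.
    apply: ler_sum => i _; case: (leP `|_|) => [_|h].
      by rewrite subrr divr_ge0 ?sqr_ge0// ltW.
    rewrite subr0 ler_pdivlMr// mul1r -[leRHS]real_normK ?num_real//.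
    rewrite ler_sqr ?nnegrE// -intr_norm.
    by rewrite -[X in X <= _]/((L%:Z)%:~R) ler_int ltW.
  have J0 : 0 <= J by apply: sumr_ge0 => i _; exact: sqr_ge0.
  rewrite -/J; have -> : 2 / (m%:R * L%:R ^+ 2) * J = 2 * (J / L%:R ^+ 2) / m%:R.
    by rewrite invfM; ring.
  have JL0 : 0 <= J / L%:R ^+ 2 by rewrite divr_ge0// ltW.
  (* A path with more than half its vertices outside the band has second-moment term at least 1, so
     the trivial bound on its error suffices. *)
  have [Nm|Nm] := leP (m%:R / 2) N; last first.
    apply: (@le_trans _ _ 1%E); first exact: prodP_w_alt_le1.
    have te : 0 <= tau * e by rewrite mulr_ge0// expR_ge0.
    have : 1 <= 2 * (J / L%:R ^+ 2) / m%:R.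
      by rewrite ler_pdivlMr//; lra.
    by rewrite lee_fin; lra.
  apply: (@le_trans _ _ (tau * e)%:E); last first.
    by rewrite lee_fin lerDr divr_ge0 ?mulr_ge0// ltW.
  apply: (@le_trans _ _ (tau%:E * I (w_alt F0 m t p) (fun x => (Z x)^-1%:E))%E); last first.
    rewrite EFinM lee_wpmul2l//; apply: le_trans (IZV p pP) _.
    rewrite lee_fin ler_expR lerD2l lerN2 -[leLHS]mulrA ler_wpM2l ?mulr_ge0//.
  rewrite -iintZl//; last exact: w_alt_weight.
  apply: le_iint => //; [exact: w_alt_weight|exact: indic_mfun_ge0|].
  move=> x; rewrite -EFinM lee_fin indicE in_setC AE /T; case: (leP tau (Z x)) => [_|h].
    by rewrite mulr_ge0 ?invr_ge0// ltW.
  by rewrite ler_pdivlMr// mul1r ltW.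
apply: (@le_trans _ _ (prodP F0 m (w_null m) A + \sum_(p in Paths m) k%:E *
    prodP F0 m (w_alt F0 m t p) (~` A))%E).
  apply: ereal_inf_lbound; exists T; split => //.
  rewrite (_ : T @^-1` [set false] = ~` A)//.
  by apply/seteqP; split => x /=; rewrite /A/=; case: (T x).
rewrite -addrA EFinD; apply: leeD => //.
apply: (@le_trans _ _ (\sum_(p in Paths m) (k * (2 / (m%:R * L%:R ^+ 2) *
  (\sum_(i < m) (jval m (p i))%:~R ^+ 2) + tau * e))%:E)%E).
  by apply: lee_sum => p pP; rewrite EFinM lee_wpmul2l// PB.
rewrite sumEFin lee_fin.
have kN : k * 2 ^+ n = 1.
  by rewrite /k card_Paths natrX mulVf// expf_neq0.
rewrite -mulr_sumr big_split/= -mulr_sumr sumr_const card_Paths -[_ *+ (2 ^ n)%N]mulr_natr natrX.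
have J2 : \sum_(p in Paths m) \sum_(i < m) (jval m (p i))%:~R ^+ 2 <=
    2 ^+ n * m%:R * n%:R :> R.
  have := walk_sqr_sum R n 0; rewrite expr0n add0r => W.
  rewrite big_Paths; apply: le_trans W.
  rewrite le_eqVlt; apply/orP; left; apply/eqP.
  rewrite big_seq [RHS]big_seq; apply: eq_bigr => s; rewrite mem_bseqs => /eqP sn.
  rewrite [RHS](big_nth 0) size_walk sn big_mkord.
  by apply: eq_bigr => i _; rewrite jval_path_of.
have c0 : 0 <= 2 / (m%:R * L%:R ^+ 2) :> R by rewrite divr_ge0// mulr_ge0// ltW.
rewrite mulrDr [leRHS]addrC.
have -> : k * (tau * e * 2 ^+ n) = tau * e * (k * 2 ^+ n) by ring.
rewrite kN mulr1 lerD2r.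
apply: le_trans (ler_wpM2l k0 (ler_wpM2l c0 J2)) _.
have -> : k * (2 / (m%:R * L%:R ^+ 2) * (2 ^+ n * m%:R * n%:R)) =
   (k * 2 ^+ n) * (2 * n%:R / L%:R ^+ 2) :> R.
  rewrite invfM.
  transitivity (m%:R^-1 * m%:R * ((k * 2 ^+ n) * (2 * n%:R / L%:R ^+ 2))); first by ring.
  by rewrite mulVf ?mul1r// gt_eqF.
by rewrite kN mul1r ler_pM2r ?invr_gt0// ler_pM2l// ler_nat.
Qed.

End RiskUpper.

(** * Asymptotics *)

Section Asymptotics.
Context (R : realType) (F0 : probability R R).

Lemma cvge_dist (u : nat -> \bar R) (l : R) :
  (forall eps, 0 < eps -> \forall m \near \oo,
    ((l - eps)%:E <= u m <= (l + eps)%:E)%E) -> u @ \oo --> l%:E.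
Proof.
move=> H; apply/fine_cvgP; split.
  apply: filterS (H 1 ltr01) => m /andP[h1 h2].
  by rewrite fin_numE; apply/andP; split;
    [rewrite gt_eqF// (lt_le_trans _ h1)// ltNyr|rewrite lt_eqF// (le_lt_trans h2)// ltry].
apply/cvgrPdist_le => eps e0; apply: filterS (H _ e0) => m /=.
case: (u m) => [r| |]; rewrite ?leye_eq ?leeNy_eq ?andbF//= ?lee_fin => /andP[h1 h2].
by rewrite ler_distlC; apply/andP; split; lra.
Qed.

Lemma bayes_risk_ge0 t n : (0 <= bayes_risk F0 t n.+1)%E.
Proof.
apply: le_ereal_inf_tmp => _ [T [mT ->]].
have P0 w (A : set (sampleM R n.+1)) : weight R n.+1 w -> measurable A ->
    (0 <= prodP F0 n.+1 w A)%E.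
  by move=> ww mA; apply: (mfun_ge0_iint _ _ _ _ _ _ ww _).2; exact: indic_mfun_ge0.
rewrite adde_ge0//; first by apply: P0; [exact: weight1|exact: mT].
apply: sume_ge0 => p _; rewrite mule_ge0 ?lee_fin ?invr_ge0//.
apply: P0; first exact: w_alt_weight.
rewrite (_ : _ @^-1` _ = ~` (T @^-1` [set true])).
  by apply: (@measurableC _ (sampleM R n.+1)); exact: mT.
by apply/seteqP; split => z /=; case: (T z).
Qed.

Lemma Paths_meet_sum (x eps beta : R) n : 0 <= x -> 0 <= eps -> 0 <= beta ->
  x * (1 + eps + n.+1%:R * (eps * beta ^+ 2 / 2)) <= eps * beta ->
  \sum_(p in Paths n.+1) \sum_(q in Paths n.+1)
    \prod_(i < n.+1) (if p i == q i then 1 + x else 1) <=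
  (#|Paths n.+1|%:R) ^+ 2 * (1 + (eps + n.+1%:R * (eps * beta ^+ 2 / 2))).
Proof.
move=> x0 e0 b0 H.
have := @walk_meet_sum R x eps beta x0 e0 b0 n.+1 n 0 0 H (ltnSn n).
rewrite subrr /barrier normr0 mulr0 mul0r subr0 expr1n mulr1 -addrA.
rewrite card_Paths natrX (_ : (2 ^+ n) ^+ 2 = 4 ^+ n :> R); last first.
  by rewrite exprAC -natrX.
apply: le_trans; rewrite le_eqVlt; apply/orP; left; apply/eqP.
rewrite big_Paths big_seq [RHS]big_seq; apply: eq_bigr => s; rewrite mem_bseqs => /eqP sn.
rewrite big_Paths big_seq [RHS]big_seq; apply: eq_bigr => t; rewrite mem_bseqs => /eqP tn.
rewrite /meet_weight (big_nth (0, 0)) size_zip !size_walk sn tn minnn big_mkord.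
apply: eq_bigr => i _; rewrite nth_zip ?size_walk ?sn ?tn//=.
by rewrite path_of_eq.
Qed.

(** Here [u] stands for [m^(1/4)], which keeps real powers out of the estimates. *)
Lemma risk_powerless (eta : R) : mgf_finite_near0 F0 -> 0 < eta ->
  exists2 d, 0 < d & forall n t u, 0 < t -> 1 <= u -> u ^+ 4 = n.+1%:R -> t * u <= d ->
    ((1 - eta)%:E <= bayes_risk F0 t n.+1 <= 1%:E)%E.
Proof.
move=> /(second_moment_density R F0)[C [r [C0 r0 HC]]] eta0.
pose eps := eta ^+ 2 / 2; have eps0 : 0 < eps by rewrite divr_gt0// exprn_gt0.
pose B := C * (1 + 3 / 2 * eps) + 1.
have B1 : 1 <= B by rewrite /B lerDr mulr_ge0//; lra.
have B0 : 0 < B by lra.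
(* [r / 2] puts [t] in the range of the second-moment bound, as [t <= t * u]; 1 gives
   [(t * u) ^+ 2 <= d]; [eps / B] yields the supersolution condition. *)
pose d := Num.min (r / 2) (Num.min 1 (eps / B)).
have d0 : 0 < d.
  by rewrite !lt_min ltr01 (divr_gt0 r0 (ltr0n _ 2)) (divr_gt0 eps0 B0).
have dr : d <= r / 2 by rewrite ge_min lexx.
have d1 : d <= 1 by rewrite !ge_min lexx orbT.
have dB : d * B <= eps by rewrite -ler_pdivlMr// !ge_min lexx !orbT.
exists d => // n t u t0 u1 u4 tud.
have u0 : 0 < u by lra.
have tr : t < r by have : t <= t * u by [rewrite ler_peMr// ltW|]; lra.
have [|phi0 ft [c cE cC]] := HC t; first by rewrite t0.
rewrite bayes_risk_le1// andbT.
have x0 : 0 <= C * t ^+ 2 by rewrite mulr_ge0// sqr_ge0.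
apply: (risk_lower _ _ _ _ phi0 ft c (C * t ^+ 2)) => //.
(* The slope [beta = u ^- 2 = m^(-1/2)] makes the accumulated variance term equal to [eps / 2] for
   every [m]. The total [3 / 2 * eps] is below [eta ^+ 2], and the condition on [x = C * t ^+ 2]
   becomes one on [t * u] alone. *)
have b0 : 0 <= u ^- 2 by rewrite invr_ge0 sqr_ge0.
have E : n.+1%:R * (eps * (u ^- 2) ^+ 2 / 2) = eps / 2.
  by rewrite -u4; field; rewrite gt_eqF.
apply: le_trans (Paths_meet_sum _ _ _ _ x0 (ltW eps0) b0 _) _; rewrite E.
  rewrite ler_pdivlMr ?exprn_gt0//.
  have -> : C * t ^+ 2 * (1 + eps + eps / 2) * u ^+ 2 =
     (C * (1 + 3 / 2 * eps)) * (t * u) ^+ 2 by field.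
  have tu0 : 0 <= t * u by rewrite mulr_ge0// ltW.
  have tu2 : (t * u) ^+ 2 <= d.
    apply: (@le_trans _ _ (d ^+ 2)); first by rewrite ler_sqr ?nnegrE// ltW.
    by rewrite expr2 ler_piMr// ltW.
  apply: le_trans (ler_wpM2l _ tu2) _; first by rewrite mulr_ge0//; lra.
  by move: dB; rewrite /B; lra.
by rewrite ler_wpM2l ?sqr_ge0// lerD2l /eps; have := sqr_ge0 eta; lra.
Qed.

Lemma risk_powerful (eta : R) : nondegenerate_law F0 -> 0 < eta ->
  exists2 M, 0 < M & forall n t u, 0 < t -> mgf_finite F0 t -> u ^+ 4 = n.+1%:R ->
    M <= u -> M <= t * u -> (bayes_risk F0 t n.+1 <= eta%:E)%E.
Proof.
move=> /(nondegenerate_split R F0)[a [e [e0 Fa Fb]]] eta0.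
have Ff (A : set R) : measurable A -> (F0 A = (fine (F0 A))%:E)%E.
  move=> mA; rewrite fineK// ge0_fin_numE ?measure_ge0//.
  by apply: le_lt_trans (probability_le1 _ mA) _; rewrite ltry.
set q := fine (F0 `]a, +oo[%classic).
have qF : F0 `]a, +oo[%classic = q%:E by rewrite Ff.
have q0 : 0 <= q by exact: fine_ge0.
have q1 : q < 1 by rewrite -lte_fin -qF.
set b := e * fine (F0 `](a + e)%R, +oo[%classic).
have b0 : 0 < b by rewrite mulr_gt0// -lte_fin -Ff.
have Fa0 : (0 < F0 `]a, +oo[%classic)%E.
  apply: lt_le_trans Fb _; apply: le_measure; rewrite ?inE//.
  move=> x/=; rewrite !in_itv/= !andbT; apply: le_lt_trans.
  by rewrite lerDl ltW.
(* [K] is the band width in units of [sqrt m], large enough for the paths that leave the band to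
   cost at most [eta / 2]. *)
pose K := (Num.truncn (2 / eta)).+2.
have K2 : 2 / eta < K%:R.
  by apply: lt_trans (truncnS_gt _) _; rewrite ltr_nat.
have KK : 2 / K%:R ^+ 2 <= eta / 2.
  have K2' : 2 <= K%:R :> R by rewrite ler_nat.
  rewrite ler_pdivrMr ?exprn_gt0// expr2.
  have : 2 < K%:R * eta by rewrite -ltr_pdivrMr.
  by nra.
(* Chosen backwards: [del * u >= M0] will give [1 + s >= 4 / eta]. [M1] makes up for the factor
   [1 - q] in [del] and the 1/2 lost in [delu]; [M] ensures both [u >= M1] and [t * b * u >= M1]. *)
pose M0 := 1 + 24 * 64 * K%:R / eta.
have M01 : 1 <= M0 by rewrite lerDl divr_ge0 ?mulr_ge0// ltW.
pose M1 := 2 * M0 / (1 - q).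
have M11 : 1 <= M1 by rewrite /M1 ler_pdivlMr ?subr_gt0//; lra.
pose M := M1 + M1 / b.
have MM1 : M1 <= M by rewrite lerDl divr_ge0 ?ltW//; lra.
have MbM1 : M1 <= M * b.
  by rewrite /M mulrDl divfK ?gt_eqF// lerDr mulr_ge0 ?ltW//; lra.
exists M; first by lra.
move=> n t u t0 ft u4 Mu Mtu.
have u1 : 1 <= u by lra.
have u0 : 0 < u by lra.
have phi0 : 0 < mgf F0 t by exact: (mgf_gt0 R F0 a).
have [Q QE dQ] := tail_gain R F0 a e t e0 t0 ft phi0 (ltW q1).
rewrite -/q -/b in dQ.
have Q0 : 0 <= Q.
  rewrite -lee_fin -QE; apply: integral_ge0 => y _.
  by rewrite lee_fin mulr_ge0 ?density_ge0// two_val_ge0.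
have Q1 : Q <= 1.
  rewrite -lee_fin -QE -(integral_density R F0 t phi0 ft); apply: ge0_le_integral => //.
  - by move=> y _; rewrite lee_fin mulr_ge0 ?density_ge0// two_val_ge0.
  - apply/measurable_EFinP; apply: measurable_funM; first exact: measurable_density.
    exact: measurable_two_val.
  - by apply/measurable_EFinP; exact: measurable_density.
  - move=> y _; rewrite lee_fin /two_val; case: ifP => _; rewrite ?mulr1// mulr0.
    exact: density_ge0.
set del := (1 - q) * (t * b / (1 + t * b)) in dQ.
have tb0 : 0 < t * b by exact: mulr_gt0.
have del0 : 0 <= del by rewrite mulr_ge0 ?divr_ge0//; lra.
have del1 : del <= 1 by lra.
have delu : M0 <= del * u.
  (* Small and saturated [t] are treated together: clearing the denominator leaves
     [M1 (1 + t b) <= 2 t b u], which follows from [M1 <= t b u] and [M1 <= u]. *)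
  have : M1 / 2 <= t * b / (1 + t * b) * u.
    rewrite [leRHS]mulrAC ler_pdivlMr; last by lra.
    have h1 : M1 <= t * b * u.
      apply: le_trans MbM1 _; rewrite mulrAC; exact: (ler_wpM2r (ltW b0) Mtu).
    have h2 : M1 <= u by lra.
    have : M1 * (t * b) <= u * (t * b) by rewrite ler_wpM2r// ltW.
    by lra.
  move=> h; rewrite /del -mulrA.
  have -> : M0 = (1 - q) * (M1 / 2) by rewrite /M1; field; lra.
  by rewrite ler_wpM2l//; lra.
pose T := (Num.truncn (u ^+ 2)).+1; pose L := (K * T)%N.
have u20 : 0 <= u ^+ 2 by exact: sqr_ge0.
have Tu : u ^+ 2 < T%:R by exact: truncnS_gt.
have uT : T%:R <= 2 * u ^+ 2.
  rewrite /T -natr1.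
  have : (Num.truncn (u ^+ 2))%:R <= u ^+ 2 by rewrite truncn_le.
  have : 1 <= u ^+ 2 by rewrite exprn_ege1.
  by lra.
have T0 : 0 < T%:R :> R by [].
have K0 : 0 < K%:R :> R by [].
have LE : L%:R = K%:R * T%:R :> R by rewrite natrM.
have L0 : 0 < L%:R :> R by rewrite LE mulr_gt0.
have L1 : 1 <= L%:R :> R by rewrite ler1n.
(* Minimiser of [6 lam^2 m L - lam del m / 2], the minimum being [- 2 s] for the [s] below. The
   threshold [expR s] then makes both exponential terms equal to [expR (- s)]. *)
pose lam := del / (24 * L%:R).
have lam01 : 0 <= lam <= 1 / 2.
  apply/andP; split; first by rewrite divr_ge0// mulr_ge0// ltW.
  by rewrite ler_pdivrMr ?mulr_gt0//; lra.
pose s := del ^+ 2 * n.+1%:R / (24 * 8 * L%:R).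
have qE : (\int[F0]_y (two_val R a 1 0 y)%:E = q%:E)%E by rewrite integral_two_val10.
have := @risk_upper R F0 n t a q Q del lam (expR s) L phi0 ft qE QE.
rewrite q0 (ltW q1) Q0 Q1 del0 dQ lam01 expR_gt0 -(ltr0n R) L0.
move=> /(_ isT isT isT isT isT isT) Hr; apply: (le_trans Hr); rewrite lee_fin -expRN -expRD.
have -> : s + (6 * lam ^+ 2 * n.+1%:R * L%:R - lam * del * n.+1%:R / 2) = - s.
  by rewrite /s /lam; field; rewrite gt_eqF.
have sM : 4 / eta <= 1 + s.
  (* Since [T <= 2 u^2], [s] is at least [(del u)^2 / (24 * 16 * K)], and [M0 ^+ 2 >= M0]. *)
  have : M0 / (24 * 16 * K%:R) <= s.
    rewrite /s -u4 LE ler_pdivlMr ?mulr_gt0// mulrAC ler_pdivrMr ?mulr_gt0//.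
    apply: (@le_trans _ _ ((del * u) ^+ 2 * u ^+ 2 * (24 * 16 * K%:R))); last first.
      by rewrite le_eqVlt; apply/orP; left; apply/eqP; ring.
    have -> : M0 * (24 * 8 * (K%:R * T%:R)) = M0 * (T%:R / 2) * (24 * 16 * K%:R) by field.
    rewrite ler_pM2r ?mulr_gt0//; apply: ler_pM => //; try lra.
    by nra.
  rewrite ler_pdivrMr ?mulr_gt0//.
  rewrite ler_pdivrMr//.
  have -> : M0 = 1 + 24 * 16 * K%:R * (4 / eta) by rewrite /M0; field; rewrite gt_eqF.
  move=> h; have : 24 * 16 * K%:R * (4 / eta) <= 24 * 16 * K%:R * s by lra.
  rewrite ler_pM2l ?mulr_gt0// => h2.
  by rewrite -ler_pdivrMr//; lra.
have es : expR (- s) <= eta / 4.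
  rewrite expRN -[eta / 4]invrK lef_pV2 ?posrE ?expR_gt0 ?invr_gt0 ?divr_gt0//.
  by rewrite invf_div; apply: le_trans sM (expR_ge1Dx _).
have last : 2 * n.+1%:R / L%:R ^+ 2 <= eta / 2.
  apply: le_trans KK; rewrite LE -u4 ler_pdivrMr ?exprn_gt0 ?mulr_gt0//.
  have -> : 2 / K%:R ^+ 2 * (K%:R * T%:R) ^+ 2 = 2 * T%:R ^+ 2 :> R.
    by field; rewrite gt_eqF.
  by rewrite ler_pM2l// -[4%N]/(2 * 2)%N exprM ler_sqr ?nnegrE// ltW.
by lra.
Qed.

Lemma powR_quarter n : (n.+1%:R `^ 4^-1) ^+ 4 = n.+1%:R :> R.
Proof. by rewrite -powR_mulrn ?powR_ge0// -powRrM mulVf ?powRr1. Qed.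

End Asymptotics.

Theorem theorem4p2 (R : realType) (F0 : probability R R) (theta : nat -> R) :
  nondegenerate_law F0 ->
  mgf_finite_near0 F0 ->
  (forall m, 0 < theta m) ->
  (forall m, mgf_finite F0 (theta m)) ->
  (((fun m : nat => theta m * powR (m%:R) (4^-1)) @ \oo --> +oo) ->
     (fun m => bayes_risk F0 (theta m) m) @ \oo --> 0%E) /\
  (((fun m : nat => theta m * powR (m%:R) (4^-1)) @ \oo --> 0) ->
     (fun m => bayes_risk F0 (theta m) m) @ \oo --> 1%E).
Proof.
move=> nd near0 th0 thf; split => lim; apply: cvge_dist => eps eps0.
  have [M M0 HM] := risk_powerful R F0 eps nd eps0.
  (* [risk_powerful] also needs [m^(1/4) >= M], which the limit hypothesis alone does not give at a
     fixed [m] because [theta m] may be large. *)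
  have big : \forall m \near \oo, M ^+ 4 <= (m%:R : R) by exact: nbhs_infty_ger.
  move/cvgryPge : lim => /(_ M) lim.
  apply: filterS3 (nbhs_infty_gt 0) big lim => -[//|n] _ Mm Mt.
  rewrite sub0r add0r (@le_trans _ _ 0%E) ?bayes_risk_ge0 ?lee_fin ?oppr_le0 ?(ltW eps0)//=.
  apply: (HM n _ (n.+1%:R `^ 4^-1)) => //; first exact: powR_quarter.
  by rewrite -(@ler_pXn2r _ 4) ?nnegrE ?powR_ge0 ?(ltW M0)// powR_quarter.
have [d d0 Hd] := risk_powerless R F0 eps near0 eps0.
move/cvgrPdist_le : lim => /(_ _ d0) lim.
apply: filterS2 (nbhs_infty_gt 0) lim => -[//|n] _; rewrite sub0r normrN => dt.
have u1 : 1 <= n.+1%:R `^ 4^-1 :> R.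
  by rewrite -(@ler_pXn2r _ 4) ?nnegrE ?powR_ge0// powR_quarter expr1n ler1n.
have /andP[-> h] := Hd n (theta n.+1) _ (th0 _) u1 (powR_quarter R n) (le_trans (ler_norm _) dt).
by apply: le_trans h _; rewrite lee_fin lerDl ltW.
Qed.
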